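(* Let $k$ be an algebraic number field of degree $d$ over $\mathbb{Q}$, and assume that $k$ has at least one embedding into $\mathbb{R}$. Let $s$ be the number of complex places of $k$ and let $\Delta_k$ be the discriminant of $k$. Then there exists an element $\alpha \in k$ such that $$k = \mathbb{Q}(\alpha) \quad\text{and}\quad H(\alpha) \le \Bigl(\frac{2}{\pi}\Bigr)^{s/d} |\Delta_k|^{1/(2d)}.$$
   Context: $H(\alpha)$ denotes the absolute multiplicative Weil height of an algebraic number $\alpha$: if $\alpha$ lies in a number field $K$ of degree $n$, then $H(\alpha) = \prod_v \max\{1, \|\alpha\|_v\}^{n_v/n}$, the product over all places $v$ of $K$, where $\|\cdot\|_v$ is the absolute value at $v$ extending the usual archimedean or $p$-adic absolute value on $\mathbb{Q}$ and $n_v = [K_v:\mathbb{Q}_v]$ is the local degree. *)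

(* Defs.v *)
From HB Require Import structures.
From mathcomp Require Import all_boot all_order all_algebra all_field.
From mathcomp Require Import finmap complex.
From mathcomp Require Import all_classical all_reals all_analysis.

Set Implicit Arguments.
Unset Strict Implicit.
Unset Printing Implicit Defensive.

Import Order.TTheory GRing.Theory Num.Theory.

Local Open Scope classical_set_scope.
Local Open Scope ring_scope.

(* A number field is a [fieldExtType rat], i.e. a finite extension of [rat];
   its degree over the rationals is [\dim {:k}]. *)

Definition absolute_value (R : realType) (F : fieldType) (v : F -> R) : Prop :=
  [/\ forall x, 0 <= v x,
      forall x, v x = 0 <-> x = 0,
      forall x y, v (x * y) = v x * v y
    & forall x y, v (x + y) <= v x + v y].

Definition padic_abs (R : realType) (p : nat) (q : rat) : R :=
  if q == 0 then 0
  else p%:R ^ ((logn p `|denq q|%N)%:Z - (logn p `|numq q|%N)%:Z).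

Section Places.
Variables (R : realType) (k : fieldExtType rat).
Implicit Type v : k -> R.

Definition extends_archimedean v : Prop :=
  forall q : rat, v q%:A = `|ratr q|.

Definition extends_padic (p : nat) v : Prop :=
  forall q : rat, v q%:A = padic_abs R p q.

(* A place is an equivalence class of nontrivial absolute values.  Each class
   contains exactly one absolute value extending the usual or a p-adic absolute
   value of the rationals; that normalised member represents the place. *)
Definition places : set (k -> R) :=
  [set v | absolute_value v /\
     (extends_archimedean v \/
      exists2 p : nat, prime p & extends_padic p v)].

Definition complex_places : set (k -> R) :=
  [set v | places v /\
     exists sigma : {rmorphism k -> R[i]},
       (exists x, complex.Im (sigma x) != 0) /\
       forall x, v x = ComplexField.Normc.normc (sigma x)].

End Places.

(* [k_v]: a complete valued field in which [k], valued by [v], is dense. *)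
Record completion (R : realType) (k : fieldExtType rat) (v : k -> R) :=
  Completion {
    comp_field : fieldType;
    comp_abs : comp_field -> R;
    comp_emb : {rmorphism k -> comp_field};
    comp_abs_valued : absolute_value comp_abs;
    comp_abs_emb : forall x, comp_abs (comp_emb x) = v x;
    comp_dense : forall (y : comp_field) (e : R), 0 < e ->
      exists x : k, comp_abs (y - comp_emb x) < e;
    comp_complete : forall u : nat -> comp_field,
      (forall e : R, 0 < e -> exists N : nat, forall m n : nat,
         (N <= m)%N -> (N <= n)%N -> comp_abs (u m - u n) < e) ->
      exists l : comp_field, forall e : R, 0 < e ->
        exists N : nat, forall n : nat, (N <= n)%N -> comp_abs (u n - l) < e }.

(* [Q_v], as the closure of the rationals in [k_v]. *)
Definition rat_closure (R : realType) (k : fieldExtType rat) (v : k -> R)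
    (C : completion v) : set (comp_field C) :=
  [set y | forall e : R, 0 < e ->
     exists q : rat, comp_abs (y - comp_emb C q%:A) < e].

(* [n] is the dimension of [k_v] over [Q_v]: there is a basis of size [n]. *)
Definition is_local_degree (R : realType) (k : fieldExtType rat) (v : k -> R)
    (n : nat) : Prop :=
  exists (C : completion v) (b : 'I_n -> comp_field C),
    forall y : comp_field C, exists! c : {ffun 'I_n -> comp_field C},
      (forall i, rat_closure (c i)) /\ y = \sum_i c i * b i.

(* Completions are unique up to isomorphism and finite over [Q_v], so exactly
   one [n] qualifies and the default value 0 is never used. *)
Definition local_degree (R : realType) (k : fieldExtType rat) (v : k -> R)
    : nat :=
  xget 0%N [set n | is_local_degree v n].

(* Only finitely many factors differ from 1, so the finitely supported product
   is the product over all places. *)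
Definition weil_height (R : realType) (k : fieldExtType rat) (alpha : k) : R :=
  \big[*%R/1]_(v \in @places R k)
    (Num.max 1 (v alpha) `^ ((local_degree v)%:R / (\dim {:k})%:R)).

Section Discriminant.
Variable k : fieldExtType rat.

Definition alg_integer (x : k) : Prop := integralOver (intr : int -> k) x.

Definition field_trace (x : k) : rat :=
  \tr (\matrix_(i < \dim {:k}, j < \dim {:k})
         coord (vbasis {:k}) j (x * (vbasis {:k})`_i)).

Definition integral_basis (b : 'I_(\dim {:k}) -> k) : Prop :=
  (forall i, alg_integer (b i)) /\
  forall x, alg_integer x ->
    exists! z : {ffun 'I_(\dim {:k}) -> int}, x = \sum_i b i *~ z i.

(* All integral bases give the same determinant and one always exists, so the
   default value 0 is never used. *)
Definition field_disc : rat :=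
  xget 0 [set D | exists2 b, integral_basis b &
                   D = \det (\matrix_(i, j) field_trace (b i * b j))].

End Discriminant.

(* Main.v *)
Require Import Defs.
From HB Require Import structures.
From mathcomp Require Import all_boot all_order all_algebra all_field.
From mathcomp Require Import finmap complex.
From mathcomp Require Import all_classical all_reals all_analysis.
From mathcomp Require Import ring lra zify.

(* Minkowski's convex body theorem, applied to the integers of [k], gives a
   nonzero integer [alpha] whose image under the given real embedding [sigma0]
   has absolute value at most [(2 / pi) ^ s |disc| ^ (1/2)] while all other
   conjugates have absolute value less than 1.  As the norm of [alpha] is at
   least 1, the conjugate [sigma0 alpha] is larger than all the others, so
   [alpha] generates [k]; and the place of [sigma0], of local degree 1, is the
   only one with [v alpha > 1], so [H(alpha) ^ d = |sigma0 alpha|].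

   Minkowski's theorem itself is proved by counting: after rounding the lattice
   to a fine integral one, of index |det|, the integral points of half the body
   are too many to be pairwise incongruent.

   The height is only needed from above, so neither the finiteness of the set
   of places nor the existence of completions plays a role.  An archimedean
   absolute value [v] is bounded by a multiple of the sum of the conjugate
   absolute values; comparing powers then forces [v = |sigma0|] as soon as
   [v alpha > 1]. *)

Set Implicit Arguments.
Unset Strict Implicit.
Unset Printing Implicit Defensive.

Import Order.TTheory GRing.Theory Num.Theory.
Import numFieldNormedType.Exports.

Local Open Scope classical_set_scope.
Local Open Scope ring_scope.

(** * Minkowski's theorem for products of intervals and discs *)

Lemma absz_det_unitmx n (L : 'M[int]_n) : L \in unitmx -> `|\det L|%N = 1%N.
Proof.
by rewrite unitmxE => /unitrP[x [_ /(congr1 absz)]]; rewrite abszM => /eqP;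
  rewrite muln_eq1 => /andP[/eqP].
Qed.

(* The cosets of [B int^n] number [|det B|]: read off the Smith normal form. *)
Lemma pigeonhole_mod_mx n (B : 'M[int]_n) (F : finType) (S : {set F})
    (psi : F -> 'cV[int]_n) :
  \det B != 0 -> {in S &, injective psi} -> (`|\det B| < #|S|)%N ->
  exists f g z, [/\ f \in S, g \in S, z != 0 & psi f - psi g = B *m z].
Proof.
move=> nzB psi_inj ltBS.
have [L uL [U uU [s _ defB]]] := int_Smith_normal_form B.
pose e (i : nat) : int := s`_i.
pose D : 'M[int]_n := \matrix_(i, j) (e i *+ (i == j :> nat)).
have defD : D = diag_mx (\row_i e i).
  by apply/matrixP=> i j; rewrite !mxE -val_eqE.
have detB : `|\det B|%N = (\prod_(i < n) `|e i|)%N.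
  rewrite defB !det_mulmx !abszM (absz_det_unitmx uL) (absz_det_unitmx uU) mul1n muln1.
  rewrite -/D defD det_diag.
  rewrite (big_morph absz abszM (erefl : `|1|%N = 1%N)).
  by apply: eq_bigr => i _; rewrite mxE.
have s_gt0 i : (i < n)%N -> (0 < `|e i|)%N.
  move=> lt_i; rewrite absz_gt0; apply: contraNneq nzB => si0.
  by rewrite -absz_eq0 detB (bigD1 (Ordinal lt_i)) //= si0 mul0n.
pose K := (\sum_(i < n) `|e i|)%N.
(* In the coordinates given by [L] the lattice [B int^n] becomes [D int^n], as [U] is unimodular. A
   coset is thus read off from the residues modulo the invariant factors [e i]. *)
pose y f := invmx L *m psi f.
pose cl f : {ffun 'I_n -> 'I_K.+1} :=
  [ffun i => inord `|((y f) i ord0 %% e i)%Z|].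
pose box := family (fun i : 'I_n => [pred t : 'I_K.+1 | (t < `|e i|)%N]).
have modlt (i : 'I_n) x : (`|(x %% e i)%Z| < `|e i|)%N.
  by rewrite -ltz_nat gez0_abs ?modz_ge0 ?ltz_mod // -absz_gt0 s_gt0.
have leK (i : 'I_n) : (`|e i| <= K)%N by rewrite /K (bigD1 i) //= leq_addr.
have card_box : #|box| = `|\det B|%N.
  rewrite card_family detB foldrE big_map big_enum /=.
  apply: eq_bigr => i _; rewrite -[RHS]card_ord.
  have lei : (`|e i| <= K.+1)%N by rewrite ltnW // ltnS leK.
  have inj : injective (widen_ord lei) by move=> u v /(congr1 val) /= /val_inj.
  rewrite -(fintype.card_image inj); apply: eq_card => t.
  apply/idP/idP => [lt_t | /mapP[u _ ->]]; last by rewrite unfold_in /=.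
  by apply/mapP; exists (Ordinal lt_t); rewrite ?mem_enum //; apply: val_inj.
have cl_box f : cl f \in box.
  apply/familyP => i; rewrite ffunE unfold_in /= inordK ?modlt //.
  by rewrite ltnS (leq_trans (ltnW (modlt i _))).
have : ~ {in S &, injective cl}.
  move=> /card_in_imset eqS; move: ltBS; rewrite ltnNge -eqS -card_box.
  case/negP; apply: subset_leq_card; apply/fintype.subsetP => c.
  by move=> /imsetP[g _ ->]; apply: cl_box.
move=> ninj.
have /existsNP[f /existsNP[g /not_implyP[fS /not_implyP[gS /not_implyP[eqfg nfg]]]]] :
  ~ forall f g, f \in S -> g \in S -> cl f = cl g -> f = g.
  by move=> h; apply: ninj => f g fS gS; apply: h.
have dvds (i : 'I_n) : (e i %| (y f - y g) i ord0)%Z.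
  rewrite !mxE -eqz_mod_dvd.
  have := congr1 (fun c : {ffun 'I_n -> 'I_K.+1} => nat_of_ord (c i)) eqfg.
  have hlt h : (`|((y h) i ord0 %% e i)%Z| < K.+1)%N.
    by rewrite ltnS (leq_trans (ltnW (modlt i _))).
  rewrite !ffunE !inordK //; rewrite !mxE => eqm.
  have nz : e i != 0 by rewrite -absz_gt0 s_gt0.
  by apply/eqP; rewrite -[LHS]gez0_abs ?modz_ge0 // eqm gez0_abs ?modz_ge0.
pose w : 'cV[int]_n := \col_i (((y f - y g) i ord0) %/ e i)%Z.
have Dw : D *m w = y f - y g.
  rewrite defD mul_diag_mx; apply/matrixP => i j; rewrite (ord1 j).
  by rewrite !mxE mulrC; have := divzK (dvds i); rewrite !mxE.
have eqz : psi f - psi g = B *m (invmx U *m w).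
  rewrite defB -!mulmxA (mulmxA U) mulmxV // mul1mx -/D Dw /y -mulmxBr mulmxA.
  by rewrite mulmxV // mul1mx.
exists f, g, (invmx U *m w); split=> //.
apply: contra_notN nfg => /eqP z0; apply: psi_inj => //; apply/eqP.
by rewrite -subr_eq0 eqz z0 mulmx0.
Qed.

(** * Unit squares inside a quarter disc *)

Section Circle.
Variable R : realType.

(* The area below the unit circle between the angles [a] and [b], bounded by
   the rectangle of height [cos a] on the same base. *)
Lemma sector_le (a b : R) : 0 <= a -> a <= b -> b <= pi / 2 ->
  (b + sin b * cos b) / 2 - (a + sin a * cos a) / 2 <=
  (sin b - sin a) * cos a.
Proof.
move=> a0 ab bpi.
(* [(t + sin t * cos t) / 2] is a primitive of [cos t ^ 2], so [H] has derivative
   [cos t * (cos a - cos t)], which is nonnegative on the interval. *)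
pose H (t : R) := (sin t - sin a) * cos a - (t + sin t * cos t) / 2.
have dH (t : R) : is_derive t 1 H (cos t * (cos a - cos t)).
  apply: is_derive_eq.
  rewrite /GRing.scale /=.
  have := cos2Dsin2 t; set c := cos t; set d := sin t => e.
  have -> : d * - d = c ^+ 2 - 1 by rewrite -e; ring.
  by field.
suff : H a <= H b by rewrite /H; lra.
apply: (@ger0_derive1_ndecr _ H a b) => //.
- move=> t tab; rewrite derive1E (@derive_val _ _ _ _ _ _ _ (dH t)).
  move: tab; rewrite in_itv /= => /andP[at_ tb].
  have pp := pi_gt0 R.
  rewrite mulr_ge0 ?cos_ge0_pihalf //; first by lra.
  case: (ltgtP a t) at_ => // lt_at _.
  have : cos t < cos a by rewrite ltr_cos ?in_itv /=; lra.
  lra.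
- by move=> t; apply: derivable_within_continuous => ? _; apply: ex_derive.
Qed.

Let eq_ge0 (x : R) : x = 0 -> 0 <= x. Proof. by move->. Qed.

(** The sum is an upper Riemann sum for the area of a quarter disc of radius [n]. Integration is
    avoided by writing [i = n sin (th i)] and telescoping the area [G i] up to abscissa [i / n],
    with [sector_le] for each strip. *)
Lemma sum_sqrt_ge (n : nat) :
  (0 < n)%N ->
  pi / 4 * n%:R ^+ 2 <= \sum_(i < n) Num.sqrt (n%:R ^+ 2 - i%:R ^+ 2) :> R.
Proof.
move=> n_gt0; have n0 : (0 : R) < n%:R by rewrite ltr0n.
pose th (i : nat) : R := asin (i%:R / n%:R).
have itv (i : nat) : (i <= n)%N -> -1 <= (i%:R / n%:R : R) <= 1.
  move=> le_in; rewrite ler_pdivrMr // mul1r ler_nat le_in andbT.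
  by apply: le_trans (_ : 0 <= _); rewrite ?lerN10 // divr_ge0.
pose G (i : nat) : R := (th i + sin (th i) * cos (th i)) / 2.
have Gn : G n = pi / 4.
  rewrite /G /th divff ?gt_eqF //.
  have h : (pi / 2 : R) \in `[(- (pi/2)), pi/2] by rewrite in_itv /=; have := pi_gt0 R; lra.
  have -> : asin 1 = pi / 2 :> R by rewrite -[in LHS](sin_pihalf R) sinK.
  by rewrite cos_pihalf mulr0 addr0; field.
have G0 : G 0%N = 0.
  rewrite /G /th mul0r.
  have h : (0 : R) \in `[(- (pi/2)), pi/2] by rewrite in_itv /=; have := pi_gt0 R; lra.
  have -> : asin 0 = 0 :> R by rewrite -[in LHS](sin0 R) sinK.
  by rewrite sin0 mul0r addr0 mul0r.
have step (i : 'I_n) : G i.+1 - G i <= Num.sqrt (n%:R ^+ 2 - i%:R ^+ 2) / n%:R ^+ 2.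
  have le1 := itv _ (ltn_ord i); have le0 := itv i (ltnW (ltn_ord i)).
  have ge0 : 0 <= (i%:R / n%:R : R) by rewrite divr_ge0 // ltW.
  have in1 x : -1 <= x <= 1 -> x \in `[(-1 : R), 1] by rewrite in_itv.
  have hpi := pi_gt0 R.
  have s1 := asin_geNpi2 le1; have s2 := asin_lepi2 le1.
  have s3 := asin_geNpi2 le0; have s4 := asin_lepi2 le0.
  have mono (x y : R) : - (pi / 2) <= x <= pi / 2 -> - (pi / 2) <= y <= pi / 2 ->
      sin x <= sin y -> x <= y.
    by move=> xI yI; rewrite !leNgt; apply: contra => ltyx; rewrite ltr_sin.
  have hi : - (pi / 2) <= th i <= pi / 2 by rewrite s3.
  have hi1 : - (pi / 2) <= th i.+1 <= pi / 2 by rewrite s1.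
  apply: (le_trans (sector_le _ _ _)) => //.
  - by apply: mono => //; rewrite ?sin0 ?asinK ?in1 //; lra.
  - by apply: mono => //; rewrite !asinK ?in1 // ler_pM2r ?invr_gt0 // ler_nat.
  rewrite !asinK ?in1 // cos_asin //.
  have -> : 1 - (i%:R / n%:R) ^+ 2 = (n%:R ^+ 2 - i%:R ^+ 2) * (n%:R^-1 ^+ 2) :> R.
    by field; rewrite gt_eqF.
  rewrite sqrtrM; last by rewrite subr_ge0 ler_sqr ?nnegrE // ler_nat ltnW.
  rewrite sqrtr_sqr ger0_norm ?invr_ge0 ?(ltW n0) // -subr_ge0 -natr1.
  by apply: eq_ge0; field; rewrite gt_eqF.
have : G n - G 0%N <= (\sum_(i < n) Num.sqrt (n%:R ^+ 2 - i%:R ^+ 2)) / n%:R ^+ 2.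
  rewrite -(telescope_sumr G) // big_mkord mulr_suml.
  by apply: ler_sum => i _; apply: step.
by rewrite Gn G0 subr0 ler_pdivlMr ?exprn_gt0.
Qed.

Lemma sum_bool_leq (n f : nat) : (f <= n)%N -> (\sum_(b < n) (b < f) = f)%N.
Proof.
move=> le_fn; rewrite -[RHS]card_ord -sum1_card (big_ord_widen n (fun=> 1%N)) //.
by rewrite [RHS]big_mkcond; apply: eq_bigr => b _; case: ltnP.
Qed.

(* The squares [[a, a + 1] x [b, b + 1]] inside the quarter disc. *)
Definition quarter_disc (n : nat) : pred (nat * nat) :=
  fun p => (p.1.+1 ^ 2 + p.2.+1 ^ 2 <= n ^ 2)%N.

(** Row [a] holds exactly the integer part of [sqrt (n^2 - (a+1)^2)] squares. Rounding loses at most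
    1 per row, and the shift from [a] to [a+1] loses the term [n] of index 0: in total at most
    [2 n]. *)
Lemma quarter_disc_ge (n : nat) : (0 < n)%N ->
  pi / 4 * n%:R ^+ 2 - 2 * n%:R <=
  (\sum_(a < n) \sum_(b < n) quarter_disc n (a : nat, b : nat))%:R :> R.
Proof.
move=> n_gt0.
have row (a : 'I_n) : Num.sqrt (n%:R ^+ 2 - a.+1%:R ^+ 2) - 1 <=
    (\sum_(b < n) quarter_disc n (a : nat, b : nat))%:R :> R.
  set m := (n ^ 2 - a.+1 ^ 2)%N.
  have le_an : (a.+1 ^ 2 <= n ^ 2)%N by rewrite leq_sqr.
  have -> : n%:R ^+ 2 - a.+1%:R ^+ 2 = m%:R :> R by rewrite natrB // !natrX.
  pose f := Num.truncn (Num.sqrt (m%:R : R)).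
  have le_f : f%:R <= Num.sqrt (m%:R : R) by rewrite truncn_le sqrtr_ge0.
  have lt_f : Num.sqrt (m%:R : R) < f.+1%:R by rewrite truncnS_gt.
  have le_fn : (f <= n)%N.
    rewrite -(ler_nat R) (le_trans le_f) // -[leRHS]ger0_norm // -sqrtr_sqr.
    by rewrite ler_wsqrtr // -natrX ler_nat leq_subr.
  have e : (\sum_(b < n) quarter_disc n (a : nat, b : nat) = f)%N.
    rewrite -[RHS](sum_bool_leq le_fn); apply: eq_bigr => b _; congr nat_of_bool.
    rewrite /quarter_disc /= -leq_subRL // -/m.
    by rewrite /f truncn_gt_nat -[leLHS]ger0_norm // -sqrtr_sqr ler_sqrt -?natrX ?ler_nat //.
  rewrite e; move: lt_f; rewrite -natr1; lra.
have shift : \sum_(a < n) Num.sqrt (n%:R ^+ 2 - a.+1%:R ^+ 2) + n%:R =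
  \sum_(a < n) Num.sqrt (n%:R ^+ 2 - a%:R ^+ 2) :> R.
  pose g (a : nat) : R := Num.sqrt (n%:R ^+ 2 - a%:R ^+ 2).
  have : \sum_(a < n.+1) g a = \sum_(a < n) g a + g n by rewrite big_ord_recr.
  by rewrite big_ord_recl /= {1 4}/g subrr sqrtr0 addr0 expr0n subr0 sqrtr_sqr ger0_norm // addrC.
have := sum_sqrt_ge n_gt0; rewrite -shift natr_sum => le1.
have : \sum_(a < n) (Num.sqrt (n%:R ^+ 2 - a.+1%:R ^+ 2) - 1) <=
  \sum_(a < n) (\sum_(b < n) quarter_disc n (a : nat, b : nat))%:R :> R.
  by apply: ler_sum => a _.
rewrite sumrB sumr_const card_ord; lra.
Qed.
End Circle.

(** Parallelogram law for points [(x + 1/2, y + 1/2)] of the disc of squared radius [M]. *)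
Lemma parallelogram_bound (x y x' y' M : int) :
  (2 * x + 1) ^+ 2 + (2 * y + 1) ^+ 2 <= 4 * M ->
  (2 * x' + 1) ^+ 2 + (2 * y' + 1) ^+ 2 <= 4 * M ->
  (x - x') ^+ 2 + (y - y') ^+ 2 <= 4 * M.
Proof.
have : 4 * ((x - x') ^+ 2 + (y - y') ^+ 2) +
    ((2 * x + 1 + (2 * x' + 1)) ^+ 2 + (2 * y + 1 + (2 * y' + 1)) ^+ 2) =
    2 * ((2 * x + 1) ^+ 2 + (2 * y + 1) ^+ 2) +
    2 * ((2 * x' + 1) ^+ 2 + (2 * y' + 1) ^+ 2) by ring.
have : 0 <= (2 * x + 1 + (2 * x' + 1)) ^+ 2 + (2 * y + 1 + (2 * y' + 1)) ^+ 2.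
  by rewrite addr_ge0 ?sqr_ge0.
by lia.
Qed.

(** * Counting points of half the body modulo an integral lattice *)

Section Body.
(** [c] models complex conjugation on the indices of the embeddings, and [pos] picks one member of
    each conjugate pair. *)
Variables (R : realType) (n : nat) (c : 'I_n -> 'I_n) (pos : pred 'I_n).
Hypothesis cK : involutive c.
Hypothesis pos_real : forall i, c i = i -> ~~ pos i.
Hypothesis pos_conj : forall i, c i != i -> pos (c i) = ~~ pos i.

Section Count.
Variable m' : nat.
Let m := m'.+1.
Local Notation halfline := (bool * 'I_m)%type.

(* [signed_half x + 1/2] runs over the half-integers of absolute value less
   than [m]; with this shift the four quadrants of the disc are congruent. *)
Definition signed_half (x : halfline) : int :=
  if x.1 then x.2%:Z else - (x.2.+1)%:Z.

Lemma signed_half_inj : injective signed_half.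
Proof.
move=> [[] a] [[] b]; rewrite /signed_half /=; last first.
- by move=> /oppr_inj [] /val_inj ->.
- by [].
- by [].
- by move=> [] /val_inj ->.
Qed.

Lemma signed_half_bound x : - m%:Z <= signed_half x /\ signed_half x <= m%:Z.
Proof.
case: x => b a; have := ltn_ord a; rewrite /signed_half /=.
by case: b => /= lt_a; split; lia.
Qed.

Lemma signed_half_sqr x :
  (2 * signed_half x + 1) ^+ 2 <= 4 * (x.2.+1 ^ 2)%N%:Z.
Proof.
case: x => b a; rewrite /signed_half /= -mulnn PoszM.
by case: b => /=; nia.
Qed.

(** Every index gets a pair of half-lines. A fixed index uses the first entry only; a [pos] index
    uses both, for itself and for its conjugate; the others are pinned to a dummy, since [point]
    reads their coordinate off the conjugate index. *)
Let box (i : 'I_n) : pred (halfline * halfline) :=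
  if c i == i then fun p : halfline * halfline => p.2 == (true, ord0)
  else if pos i then fun p : halfline * halfline => quarter_disc m (p.1.2 : nat, p.2.2 : nat)
  else fun p : halfline * halfline => p == ((true, ord0), (true, ord0)).

Let point (f : {ffun 'I_n -> halfline * halfline}) : 'cV[int]_n :=
  \col_i if (c i == i) || pos i then signed_half (f i).1
         else signed_half (f (c i)).2.

Let point_inj : {in family box &, injective point}.
Proof.
move=> f g /familyP fB /familyP gB /matrixP eqfg; apply/ffunP => i.
have := eqfg i ord0; have := eqfg (c i) ord0; have : box i (f i) := fB i; have : box i (g i) := gB i.
rewrite !mxE cK /box.
have [ci|ci] := eqVneq (c i) i.
  move=> /= /eqP g2 /eqP f2 _ /signed_half_inj e.
  by rewrite [f i]surjective_pairing [g i]surjective_pairing f2 g2 e.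
rewrite pos_conj //=.
case: (pos i) => /= [_ _ /signed_half_inj e2 /signed_half_inj e1|/eqP-> /eqP-> //].
by rewrite [f i]surjective_pairing [g i]surjective_pairing e1 e2.
Qed.

(** The factor 4 counts the quadrants, that is the sign choices; a fixed index has the [2 m]
    half-integers between [-m] and [m]. *)
Let card_box i : (#|box i| =
  if c i == i then 2 * m else if pos i
  then 4 * \sum_(a < m) \sum_(b < m) quarter_disc m (a : nat, b : nat)
  else 1)%N.
Proof.
rewrite /box; case: eqP => [_|_].
  set d : halfline := (true, ord0).
  rewrite -sum1_card big_mkcond /=.
  rewrite (eq_bigr (fun p : halfline * halfline => nat_of_bool (p.2 == d))); last first.
    by move=> p _; rewrite unfold_in; case: eqP.
  rewrite -(pair_bigA _ (fun x y : halfline => nat_of_bool (y == d))) /=.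
  rewrite (eq_bigr (fun=> 1%N)); last first.
    by move=> x _; rewrite (bigD1 d) //= big1 // => j /negbTE->.
  by rewrite sum_nat_const muln1 card_prod card_bool card_ord.
case: (pos i); last exact: card1.
rewrite -sum1_card big_mkcond /=.
rewrite (eq_bigr (fun p : halfline * halfline =>
   nat_of_bool (quarter_disc m (p.1.2 : nat, p.2.2 : nat)))); last first.
  by move=> p _; rewrite unfold_in; case: quarter_disc.
rewrite -(pair_bigA _ (fun x y : halfline => nat_of_bool (quarter_disc m (x.2 : nat, y.2 : nat)))) /=.
rewrite -(pair_bigA _ (fun b a => \sum_(y : halfline) nat_of_bool (quarter_disc m (nat_of_ord a, y.2 : nat)))%N) /=.
rewrite big_bool /= addnn -mul2n -[4%N]/(2 * 2)%N -mulnA; congr (_ * _)%N.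
rewrite big_distrr /=; apply: eq_bigr => a _.
rewrite -(pair_bigA _ (fun b b' => nat_of_bool (quarter_disc m (nat_of_ord a, nat_of_ord b')))) /=.
by rewrite big_bool /= addnn -mul2n.
Qed.

(** Two counted points that are congruent modulo [B int^n] differ by a point of the body of double
    size. The factor [pi m^2 - 8 m] is four times the bound of [quarter_disc_ge]; the condition
    [8 <= pi m] makes it nonnegative, so that the products compare factor by factor. *)
Lemma lattice_point_exists (B : 'M[int]_n) :
  \det B != 0 -> 8 <= pi * m%:R :> R ->
  `|\det B|%N%:R < \prod_(i < n) (if c i == i then 2 * m%:R else
     if pos i then pi * m%:R ^+ 2 - 8 * m%:R else 1) :> R ->
  exists z : 'cV[int]_n, [/\ z != 0,
    forall i, c i = i -> `|(B *m z) i ord0| <= 2 * m%:Z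
  & forall i, pos i ->
      (B *m z) i ord0 ^+ 2 + (B *m z) (c i) ord0 ^+ 2 <= 4 * m%:Z ^+ 2].
Proof.
move=> nzB m_large ltB.
pose S : {set {ffun 'I_n -> halfline * halfline}} := finset (mem (family box)).
have inS f : f \in S = (f \in family box) by rewrite inE.
have cardS : (`|\det B| < #|S|)%N.
  rewrite cardsE card_family foldrE big_map big_enum /= -(ltr_nat R).
  apply: (lt_le_trans ltB); rewrite natr_prod; apply: ler_prod => i _.
  have m0 : 0 <= m%:R :> R by [].
  rewrite card_box; case: ifP => _; first by rewrite natrM lexx mulr_ge0.
  case: ifP => _; last by rewrite ler01 lexx.
  have := quarter_disc_ge R (ltn0Sn m' : 0 < m)%N.
  rewrite natrM; set q := (_%:R : R) in m0 *; move=> h.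
  rewrite expr2 mulrA -mulrBl mulr_ge0 ?subr_ge0 //=.
  by move: h; rewrite expr2; lra.
have [f [g [z [fS gS z0 eqz]]]] : exists f g z, [/\ f \in S, g \in S, z != 0 & point f - point g = B *m z].
  apply: pigeonhole_mod_mx => // f g; rewrite !inS; exact: point_inj.
exists z; rewrite -eqz; split=> // i ip.
  rewrite !mxE ip eqxx /=.
  have [h1 h2] := signed_half_bound (f i).1.
  have [h3 h4] := signed_half_bound (g i).1.
  move: (signed_half _) (signed_half _) h1 h2 h3 h4 => x y.
  move: (m : nat) => k; rewrite ler_norml; lia.
have ci : c i != i by apply: contraTneq ip => /pos_real.
rewrite !mxE ip orbT cK (pos_conj ci) ip orbF eq_sym (negbTE ci) /=.
have disc h : h \in S -> quarter_disc m ((h i).1.2 : nat, (h i).2.2 : nat).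
  rewrite inS => /familyP hB; have : box i (h i) := hB i.
  by rewrite /box (negbTE ci) ip.
have hf := disc _ fS; have hg := disc _ gS.
have castZ a b : (a.+1 ^ 2 + b.+1 ^ 2 <= m ^ 2)%N ->
    (a.+1 ^ 2)%N%:Z + (b.+1 ^ 2)%N%:Z <= m%:Z ^+ 2.
  by rewrite -PoszD expr2 -PoszM mulnn lez_nat.
apply: parallelogram_bound.
  apply: le_trans (lerD (signed_half_sqr _) (signed_half_sqr _)) _.
  by rewrite -mulrDr ler_pM2l // castZ.
apply: le_trans (lerD (signed_half_sqr _) (signed_half_sqr _)) _.
by rewrite -mulrDr ler_pM2l // castZ.
Qed.

End Count.
End Body.

(** * From integral lattices to real ones *)

Section Minkowski.
Variables (R : realType) (n : nat) (c : 'I_n -> 'I_n) (pos : pred 'I_n).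
Hypothesis cK : involutive c.
Hypothesis pos_real : forall i, c i = i -> ~~ pos i.
Hypothesis pos_conj : forall i, c i != i -> pos (c i) = ~~ pos i.

(** Each conjugate pair is charged to its [pos] member. Stated for any commutative law because it
    serves for products (volumes) and for sums (the trace form). *)
Lemma big_conj (T : Type) (idx : T) (op : Monoid.com_law idx) (F : 'I_n -> T) :
  \big[op/idx]_i (if c i == i then F i else if pos i then op (F i) (F (c i)) else idx) =
  \big[op/idx]_i F i.
Proof.
rewrite (bigID (fun i => c i == i)) [RHS](bigID (fun i => c i == i)) /=.
congr (op _ _); first by apply: eq_bigr => i ->.
rewrite (bigID pos) [RHS](bigID pos) /=.
rewrite [X in op _ X = _]big1 ?Monoid.mulm1; last first.
  by move=> i /andP[/negbTE-> /negbTE->].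
rewrite (eq_bigr (fun i => op (F i) (F (c i)))); last first.
  by move=> i /andP[/negbTE-> ->].
rewrite big_split /=; congr (op _ _).
rewrite [RHS](reindex_inj (inv_inj cK)) /=; apply: eq_bigl => i.
by rewrite cK eq_sym; have [//|ci] := eqVneq (c i) i; rewrite /= pos_conj // negbK.
Qed.

Lemma cvg_det (T : Type) (F : set_system T) (FF : Filter F)
    (M : T -> 'M[R]_n) (L : 'M[R]_n) :
  (forall i j, M t i j @[t --> F] --> L i j) -> \det (M t) @[t --> F] --> \det L.
Proof.
move=> ML; apply: cvg_big => [|s _]; first exact: add_continuous.
apply: cvgM; first exact: cvg_cst.
by apply: cvg_big => [|i _]; [exact: mul_continuous | exact: ML].
Qed.

(** The strict inequality leaves room for a dilation by [r > 1], which later absorbs the rounding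
    error. *)
Lemma exists_dilation (a b : R) : a < b -> exists2 r : R, 1 < r & r ^+ n * a < b.
Proof.
move=> ab.
have cv : (x ^+ n * a) @[x --> (1 : R)^'+] --> 1 ^+ n * a.
  apply: cvg_at_right_filter; apply: cvgMl; exact: exprn_continuous.
rewrite expr1n mul1r in cv.
near (1 : R)^'+ => r.
exists r; first by near: r; exact: nbhs_right_gt.
by near: r; apply: (cvgr_lt a).
Unshelve. all: by end_near. Qed.

Lemma cvg_floor_div (x : R) :
  (Num.floor (m%:R * x))%:~R / m%:R @[m --> \oo] --> x.
Proof.
apply/cvgrPdist_le => e e0; near=> m.
have m0 : 0 < m%:R :> R by near: m; exact: nbhs_infty_gtr.
have me : e^-1 <= m%:R by near: m; exact: nbhs_infty_ger.
have -> : x - (Num.floor (m%:R * x))%:~R / m%:R = (m%:R * x - (Num.floor (m%:R * x))%:~R) / m%:R.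
  by field; rewrite gt_eqF.
have h1 := floor_le (m%:R * x); have h2 := floorD1_gt (m%:R * x).
rewrite normrM normfV !ger0_norm ?subr_ge0 ?(ltW m0) // ler_pdivrMr //.
apply: (@le_trans _ _ 1); first by move: h2; rewrite intrD; lra.
by rewrite -ler_pdivrMl // mulr1.
Unshelve. all: by end_near. Qed.

Lemma sqr_near (u p e : R) : `|u - p| <= e -> `|p| <= 2 ->
  u ^+ 2 <= p ^+ 2 + 4 * e + e ^+ 2.
Proof.
move=> upe p2; have e0 : 0 <= e by apply: le_trans upe.
have h : `|u| <= `|p| + e.
  by have := ler_normD (u - p) p; rewrite subrK; lra.
rewrite -[u ^+ 2]real_normK ?num_real // -[p ^+ 2]real_normK ?num_real //.
have h0 : 0 <= `|u| by [].
by move: (`|u|) (`|p|) p2 h h0 => a b; nra.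
Qed.

(* Blow [A] up by [m] and round its entries down: the integral lattice so
   obtained has index about [m ^ n |det A|] in [int^n]. *)
Theorem minkowski_body (A : 'M[R]_n) : \det A != 0 ->
  2 ^+ n * `|\det A| <
    \prod_i (if c i == i then 2 else if pos i then pi else 1) ->
  exists z : 'cV[int]_n, [/\ z != 0,
    forall i, c i = i -> `|(A *m map_mx intr z) i ord0| < 1
  & forall i, pos i -> (A *m map_mx intr z) i ord0 ^+ 2 +
                       (A *m map_mx intr z) (c i) ord0 ^+ 2 < 1].
Proof.
move=> nzA /exists_dilation[r r1]; set P := (X in _ < X) => ltP.
(* The factor 2 undoes the doubling caused by taking differences; [r] turns approximate bounds for
   [A'] into strict ones for [A]. *)
pose A' : 'M[R]_n := (2 * r) *: A.
have r0 : 0 < r by apply: lt_trans r1.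
have detA' : \det A' = (2 * r) ^+ n * \det A by rewrite detZ.
have nzA' : \det A' != 0 by rewrite detA' mulf_neq0 // expf_neq0 // mulf_neq0 // ?gt_eqF.
have ltA' : `|\det A'| < P.
  rewrite detA' normrM normrX ger0_norm ?mulr_ge0 ?(ltW r0) // exprMn.
  by rewrite [2 ^+ n * _]mulrC -mulrA.
pose B m : 'M[int]_n := \matrix_(i, j) Num.floor (m%:R * A' i j).
pose Pm (m : nat) : R := \prod_i
  (if c i == i then 2 else if pos i then pi - 8 / m%:R else 1).
have inv_cvg : (m%:R^-1 : R) @[m --> \oo] --> (0 : R).
  apply/cvgrPdist_le => e e0; near=> m; rewrite sub0r normrN normfV normr_nat.
  rewrite -lef_pV2 ?posrE ?invrK ?invr_gt0 ?ltr0n //; near: m.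
    exact: nbhs_infty_ger.
  exact: nbhs_infty_gt.
have cvP : Pm m @[m --> \oo] --> P.
  apply: cvg_big => [|i _]; first exact: mul_continuous.
  case: ifP => _; first exact: cvg_cst.
  case: ifP => _; last exact: cvg_cst.
  rewrite -[X in _ --> X]subr0 -[X in _ - X](mulr0 8).
  by apply: cvgB; [exact: cvg_cst | apply: cvgMr].
have cvB : \det (m%:R^-1 *: map_mx intr (B m) : 'M[R]_n) @[m --> \oo] --> \det A'.
  apply: cvg_det => i j.
  rewrite (_ : (fun m => _) = (fun m : nat => (Num.floor (m%:R * A' i j))%:~R / m%:R)).
    exact: cvg_floor_div.
  by apply/funext => m; rewrite 2!mxE mulrC [B m i j]mxE.
(* As [z] is the image of [A' z] under the inverse matrix, the sum of the [|z j|] is at most [K]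
   times any bound for the entries of [A' z]. *)
pose K : R := \sum_j \sum_i `|invmx A' j i|.
have K0 : 0 <= K by rewrite sumr_ge0 // => j _; rewrite sumr_ge0.
(* The first three conditions are those of [lattice_point_exists] divided by powers of [m]; the last
   one will make the rounding error smaller than [r - 1]. *)
have [N _ hN] : \forall m \near \oo, [/\ \det (m%:R^-1 *: map_mx intr (B m) : 'M[R]_n) != 0,
   `|\det (m%:R^-1 *: map_mx intr (B m) : 'M[R]_n)| < Pm m,
   8 <= pi * m%:R :> R & 4 * K / (r - 1) + 2 * K + 1 <= m%:R].
  pose y := (`|\det A'| + P) / 2.
  near=> m; split.
  - by near: m; apply: (cvgr_neq0 (\det A')).
  - apply: (@lt_trans _ _ y); near: m.
      by apply: (cvgr_lt `|\det A'|); [exact: cvg_norm | rewrite /y; lra].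
    by apply: (cvgr_gt P) => //; rewrite /y; lra.
  - rewrite mulrC -ler_pdivrMr ?pi_gt0 //; near: m; exact: nbhs_infty_ger.
  - near: m; exact: nbhs_infty_ger.
have [] := hN N.+1 (leqnSn N); set m := N.+1 => nzBm ltBm m8 mK.
have m0 : 0 < m%:R :> R by rewrite ltr0n.
have detBm : \det (m%:R^-1 *: map_mx intr (B m) : 'M[R]_n) = m%:R^-1 ^+ n * (\det (B m))%:~R.
  by rewrite detZ det_map_mx.
have nzB : \det (B m) != 0.
  by apply: contraNneq nzBm; rewrite detBm => ->; rewrite mulr0.
have [] := @lattice_point_exists R n c pos cK pos_real pos_conj N (B m) nzB m8.
  have -> : \prod_(i < n) (if c i == i then 2 * m%:R else
     if pos i then pi * m%:R ^+ 2 - 8 * m%:R else 1) = m%:R ^+ n * Pm m :> R.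
    have -> : m%:R ^+ n = \prod_(i < n) m%:R :> R by rewrite prodr_const card_ord.
    rewrite -[\prod_(i < n) m%:R]big_conj -big_split /=; apply: eq_bigr => i _.
    case: ifP => _; first by rewrite mulrC.
    case: ifP => _; last by rewrite mulr1.
    by field; rewrite gt_eqF.
  move: ltBm; rewrite detBm normrM normrX ger0_norm ?invr_ge0 ?(ltW m0) //.
  by rewrite exprVn ltr_pdivrMl ?exprn_gt0 // -intr_norm -abszE.
move=> z [nz0 hreal hpos]; exists z.
pose w : 'cV[R]_n := A' *m map_mx intr z.
pose Z : R := \sum_j `|(z j ord0)%:~R|.
pose y i : R := ((B m *m z) i ord0)%:~R.
have Z0 : 0 <= Z by rewrite sumr_ge0.
(* The entries of [m A' - B m] are fractional parts, in [[0, 1)], so the error is at most the sum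
   [Z] of the [|z j|], divided by [m]. *)
have wy i : `|w i ord0 - y i / m%:R| <= Z / m%:R.
  have -> : w i ord0 - y i / m%:R =
     (\sum_j (m%:R * A' i j - (B m i j)%:~R) * (z j ord0)%:~R) / m%:R.
    under eq_bigr do rewrite mulrBl -mulrA.
    rewrite sumrB -mulr_sumr mulrBl mulrAC divff ?gt_eqF // mul1r.
    rewrite /w /y !mxE rmorph_sum /=; congr (_ - _ / _).
      by apply: eq_bigr => j _; rewrite !mxE.
    by apply: eq_bigr => j _; rewrite rmorphM.
  rewrite normrM normfV [X in _ / X]ger0_norm ?(ltW m0) // ler_pM2r ?invr_gt0 //.
  apply: le_trans (ler_norm_sum _ _ _) _; apply: ler_sum => j _.
  rewrite normrM ler_piMl // [B m i j]mxE ger0_norm ?subr_ge0 ?floor_le //.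
  by have := floorD1_gt (m%:R * A' i j); rewrite intrD; lra.
have ybound i : `|y i| <= 2 * m%:R.
  have sq (u v : int) : u ^+ 2 + v ^+ 2 <= 4 * m%:Z ^+ 2 -> `|u| <= 2 * m%:Z.
    move=> h; rewrite -ler_sqr ?nnegrE ?mulr_ge0 // real_normK ?num_real // exprMn.
    by apply: le_trans h; rewrite lerDl sqr_ge0.
  have h : `|(B m *m z) i ord0| <= 2 * m%:Z.
    have [ci|ci] := eqVneq (c i) i; first exact: hreal.
    case ip: (pos i); first exact: sq (hpos i ip).
    apply: (@sq _ ((B m *m z) (c i) ord0)); rewrite addrC -{2}(cK i).
    by apply: hpos; rewrite pos_conj // ip.
  by rewrite /y -intr_norm; have := h; rewrite -(ler_int R) rmorphM.
have wbound i : `|w i ord0| <= 2 + Z / m%:R.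
  have := ler_normD (w i ord0 - y i / m%:R) (y i / m%:R); rewrite subrK => h.
  apply: (le_trans h); rewrite addrC lerD // normrM normfV [X in _ / X]ger0_norm ?(ltW m0) //.
  by rewrite ler_pdivrMr.
(* This bounds [Z] in terms of itself; [2 K <= m] closes the loop and gives [Z <= 4 K], a bound
   independent of [m]. *)
have Zbound : Z <= K * (2 + Z / m%:R).
  rewrite /K mulr_suml; apply: ler_sum => j _.
  have -> : (z j ord0)%:~R = \sum_i invmx A' j i * w i ord0.
    have -> : \sum_i invmx A' j i * w i ord0 = (invmx A' *m w) j ord0 by rewrite mxE.
    by rewrite mulmxA mulVmx ?unitmxE ?unitfE // mul1mx mxE.
  rewrite mulr_suml; apply: le_trans (ler_norm_sum _ _ _) _; apply: ler_sum => i _.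
  by rewrite normrM ler_wpM2l.
have eta_lt : Z / m%:R < r - 1.
  have h1 : 2 * K <= m%:R.
    apply: le_trans mK; rewrite -addrA ler_wpDl // ?mulr_ge0 ?invr_ge0 //; lra.
  have h2 : Z <= 4 * K.
    have : K * (Z / m%:R) <= Z / 2.
      rewrite mulrA ler_pdivrMr //; nra.
    nra.
  have h3 : 4 * K / (r - 1) < m%:R by lra.
  rewrite ltr_pdivrMr //; apply: le_lt_trans h2 _.
  by rewrite -ltr_pdivrMl ?subr_gt0 // mulrC.
have wA i : (A *m map_mx intr z) i ord0 = w i ord0 / (2 * r).
  rewrite /w -scalemxAl [in RHS]mxE mulrAC divff ?mul1r // mulf_neq0 ?gt_eqF //.
have r20 : 0 < 2 * r by rewrite mulr_gt0.
split=> // i ip.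
  rewrite wA normrM normfV [X in _ / X]ger0_norm ?(ltW r20) // ltr_pdivrMr // mul1r.
  apply: le_lt_trans (wbound i) _; lra.
rewrite !wA !expr_div_n -mulrDl ltr_pdivrMr ?exprn_gt0 // mul1r.
have y4 : (y i / m%:R) ^+ 2 + (y (c i) / m%:R) ^+ 2 <= 4.
  rewrite !expr_div_n -mulrDl ler_pdivrMr ?exprn_gt0 //.
  have := hpos i ip; rewrite -(ler_int R) /y rmorphD !rmorphXn [leRHS]rmorphM rmorphXn.
  by [].
have pb j : `|y j / m%:R| <= 2.
  by rewrite normrM normfV [X in _ / X]ger0_norm ?(ltW m0) // ler_pdivrMr.
have := sqr_near (wy i) (pb i); have := sqr_near (wy (c i)) (pb (c i)).
have : 0 <= Z / m%:R by rewrite divr_ge0 // ltW.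
(* With [e = Z / m < r - 1] the two squares sum to at most
   [4 + 8 e + 2 e^2 <= 4 (1 + e)^2 < (2 r)^2]. *)
move: (Z / m%:R) eta_lt y4 => e; nra.
Unshelve. all: by end_near. Qed.

End Minkowski.

(** * Embeddings and integral bases *)

Section Embeddings.
Variables (R : realType) (k : fieldExtType rat).
Local Notation C := R[i].
Local Notation n := (\dim {:k}).
Local Notation ratk := (map_poly (in_alg k)).

Lemma exists_primitive : exists theta : k, <<1%VS; theta>>%VS = fullv.
Proof.
exists (separable_generator 1%AS {:k}).
apply/esym/eq_adjoin_separable_generator; last exact: subvf.
apply/separableP => y _; apply: pcharf0_separable => p.
by rewrite (fmorph_pchar (in_alg k)) pchar_num.
Qed.

Lemma rat_minPoly (theta : k) : <<1%VS; theta>>%VS = fullv ->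
  exists p : {poly rat}, [/\ separable_poly p, p \is monic, size p = n.+1,
    forall q, root (ratk q) theta = (p %| q)
  & forall x, exists q, x = (ratk q).[theta]].
Proof.
move=> gen.
have /polyOver1P[p defp] : minPoly 1%AS theta \is a polyOver 1%VS by exact: minPolyOver.
have rootp q : root (ratk q) theta = (p %| q).
  rewrite -(dvdp_map (in_alg k)) -defp; apply/idP/idP => [rq | /dvdpP[u ->]].
    by apply: minPoly_dvdp => //; apply/polyOver1P; exists q.
  by rewrite rootM root_minPoly orbT.
have monp : p \is monic by rewrite -(map_monic (in_alg k)) -defp monic_minPoly.
have szp : size p = n.+1.
  rewrite -(size_map_poly (in_alg k)) -defp size_minPoly; congr _.+1.
  by rewrite -gen dim_Fadjoin dimv1 muln1.
exists p; split=> //.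
  rewrite -(separable_map (in_alg k)) -defp.
  by apply: pcharf0_separable => q; rewrite (fmorph_pchar (in_alg k)) pchar_num.
move=> x; have : x \in <<1%AS; theta>>%VS by rewrite gen memvf.
by case/Fadjoin_polyP => _ /polyOver1P[q ->] ->; exists q.
Qed.

Lemma rmorph_ratk (tau : {rmorphism k -> C}) q x :
  tau (ratk q).[x] = (map_poly ratr q).[tau x].
Proof.
rewrite -horner_map -map_poly_comp; congr (_.[_]); apply: eq_map_poly => a.
by rewrite /= alg_num_field fmorph_rat.
Qed.

(** The field [k] is [rat[X]] modulo [p]. The morphism evaluates at [r] a chosen polynomial
    representing [x]; the choice does not matter, since two such polynomials differ by a multiple of
    [p]. *)
Lemma rmorph_of_root (theta : k) (p : {poly rat}) (r : C) :
  (forall q, root (ratk q) theta = (p %| q)) ->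
  (forall x, exists q, x = (ratk q).[theta]) ->
  root (map_poly ratr p) r ->
  exists tau : {rmorphism k -> C}, tau theta = r.
Proof.
move=> rootp gen /rootP pr0; have [P defP] := choice gen.
pose f x := (map_poly ratr (P x)).[r].
have fE q : f (ratk q).[theta] = (map_poly ratr q).[r].
  apply/eqP; rewrite -subr_eq0 -hornerN -hornerD -rmorphB /=.
  have /dvdpP[u ->] : p %| P (ratk q).[theta] - q.
    by rewrite -rootp rmorphB /root hornerD hornerN -defP subrr.
  by rewrite rmorphM hornerM pr0 mulr0.
have fB : zmod_morphism f.
  move=> x y; rewrite (defP x) (defP y) -hornerN -hornerD -rmorphB !fE.
  by rewrite rmorphB hornerD hornerN.
have fM : monoid_morphism f.
  split; first by have := fE 1; rewrite !rmorph1 !hornerC.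
  move=> x y; rewrite (defP x) (defP y) -hornerM -rmorphM !fE.
  by rewrite rmorphM hornerM.
pose fA := GRing.isZmodMorphism.Build k C f fB.
pose fMM := GRing.isMonoidMorphism.Build k C f fM.
pose tau : {rmorphism k -> C} := HB.pack f fA fMM.
by exists tau; have := fE 'X; rewrite !map_polyX !hornerX.
Qed.

(** The embeddings correspond to the roots of the minimal polynomial of [theta], distinct by
    separability. Distinctness is recorded at [theta], as the Vandermonde determinant will
    require. *)
Lemma exists_embeddings (theta : k) : <<1%VS; theta>>%VS = fullv ->
  exists sigma : 'I_n -> {rmorphism k -> C},
    injective (fun i => sigma i theta) /\
    forall tau : {rmorphism k -> C}, exists i, tau =1 sigma i.
Proof.
move=> /rat_minPoly[p [sepp monp szp rootp gen]].
have [rs defrs] := closed_field_poly_normal (map_poly (ratr : rat -> C) p).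
rewrite lead_coef_map (monicP monp) rmorph1 scale1r in defrs.
have szrs : size rs = n.
  by apply: succn_inj; rewrite -(size_prod_XsubC _ id) -defrs size_map_poly.
have urs : uniq rs.
  by rewrite -separable_prod_XsubC -defrs separable_map.
have rootrs (i : 'I_n) : root (map_poly (ratr : rat -> C) p) rs`_i.
  by rewrite defrs root_prod_XsubC mem_nth ?szrs.
have /choice[sigma defs] := fun i : 'I_n => rmorph_of_root rootp gen (rootrs i).
exists sigma; split=> [i j | tau].
  by rewrite !defs => /eqP; rewrite nth_uniq ?szrs // => /eqP/val_inj.
have : root (map_poly ratr p) (tau theta).
  by rewrite /root -rmorph_ratk (rootP _) ?rmorph0 // rootp.
rewrite defrs root_prod_XsubC; case/(nthP 0) => i; rewrite szrs => lti eqi.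
exists (Ordinal lti) => x; have [q ->] := gen x.
by rewrite !rmorph_ratk defs -eqi.
Qed.
End Embeddings.

Lemma rat_integral_int (K : fieldType) (f : {rmorphism rat -> K}) (q : rat) :
  integralOver (intr : int -> K) (f q) -> exists m : int, q = m%:~R.
Proof.
case=> p monp; rewrite (_ : map_poly _ p = map_poly f (map_poly intr p)); last first.
  by rewrite -map_poly_comp; apply: eq_map_poly => a /=; rewrite rmorph_int.
rewrite fmorph_root => rq.
have : (ratr q : algC) \in Num.int.
  apply: Cint_rat_Aint; first by apply/CratP; exists q.
  apply: (@root_monic_Aint (map_poly ratr (map_poly intr p))).
  - by rewrite fmorph_root.
  - by rewrite map_monic monic_map.
  - by apply/polyOverP => i; rewrite !coef_map /= rmorph_int intr_int.
by case/intrP => m; rewrite -(ratr_int algC) => /fmorph_inj ->; exists m.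
Qed.

Lemma integral_multiple (k : fieldExtType rat) (x : k) :
  exists2 N : int, N != 0 & alg_integer (x *~ N).
Proof.
have [p nzp px0] : exists2 p : {poly rat}, p != 0 & root (map_poly (in_alg k) p) x.
  have /polyOver1P[p defp] : minPoly 1%AS x \is a polyOver 1%VS by exact: minPolyOver.
  exists p; last by rewrite -defp root_minPoly.
  by rewrite -(map_poly_eq0 (in_alg k)) -defp monic_neq0 ?monic_minPoly.
have [q [a nza defp]] := rat_poly_scale p.
have qx0 : root (map_poly (intr : int -> k) q) x.
  have : root (map_poly (in_alg k) (map_poly intr q)) x.
    by move: px0; rewrite defp map_polyZ rootZ // fmorph_eq0 invr_eq0 intr_eq0.
  by rewrite -map_poly_comp (eq_map_poly (g := intr)) // => b /=; rewrite alg_num_field ratr_int.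
have nzq : q != 0 by apply: contraNneq nzp; rewrite defp => ->; rewrite map_poly0 scaler0.
pose m := (size q).-1; have szq : size q = m.+1 by rewrite prednK // size_poly_gt0.
pose l := lead_coef q; have nzl : l != 0 by rewrite lead_coef_eq0.
exists l => //.
(* This is [l^(m-1) q(X / l)]: it is monic because [l] is the leading coefficient of [q], and [x l]
   is a root. *)
pose g : {poly int} := 'X^m + \poly_(i < m) (q`_i * l ^+ (m.-1 - i)).
exists g; first by rewrite monicE lead_coefDl ?lead_coefXn // size_polyXn ltnS size_poly.
rewrite /root rmorphD /= map_polyXn hornerD hornerXn.
have gcoef : (map_poly intr (\poly_(i < m) (q`_i * l ^+ (m.-1 - i)))).[x *~ l] =
   \sum_(i < m) (q`_i * l ^+ (m.-1 - i))%:~R * (x *~ l) ^+ i :> k.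
  rewrite (@horner_coef_wide _ m); last by rewrite (leq_trans (size_poly _ _)) // size_poly.
  by apply: eq_bigr => i _; rewrite coef_map coef_poly ltn_ord.
rewrite gcoef.
case: (posnP m) => [m0|m_gt0].
  move: qx0; rewrite /root (@horner_coef_wide _ m.+1) ?(leq_trans (size_poly _ _)) ?szq //.
  rewrite m0 big_ord1 expr0 mulr1 coef_map /= -(rmorph_int (in_alg k)) fmorph_eq0 intr_eq0.
  by rewrite -[q`_0](_ : l = _) ?(negbTE nzl) // /l lead_coefE szq m0.
have : (l%:~R : k) ^+ m.-1 * (map_poly intr q).[x] = 0 by rewrite (rootP qx0) mulr0.
rewrite (@horner_coef_wide _ m.+1) ?(leq_trans (size_poly _ _)) ?szq //.
rewrite big_ord_recr /= mulrDr addrC => e; apply/eqP; rewrite -[RHS]e; congr (_ + _).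
  rewrite coef_map /= -[q`_m](_ : l = _); last by rewrite /l lead_coefE szq.
  by rewrite mulrA -exprSr prednK // -mulrzr exprMn mulrC.
rewrite big_distrr /=; apply: eq_bigr => i _.
rewrite coef_map /= rmorphM rmorphXn /= -[x *~ l]mulrzr exprMn.
have le_im : (i <= m.-1)%N by rewrite -ltnS prednK.
have -> : (l%:~R : k) ^+ m.-1 = l%:~R ^+ (m.-1 - i) * l%:~R ^+ i.
  by rewrite -exprD subnK.
by ring.
Qed.

(** * Trace form, discriminant and integral bases *)

Section Lattice.
Variables (R : realType) (k : fieldExtType rat).
Local Notation C := R[i].
Local Notation n := (\dim {:k}).
Variables (theta : k) (sigma : 'I_n -> {rmorphism k -> C}).
Hypothesis sigma_inj : injective (fun i => sigma i theta).
Implicit Type b : 'I_n -> k.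

Local Notation e := (fun i : 'I_n => (vbasis {:k})`_i).

Definition embed_mx b : 'M[C]_n := \matrix_(i, j) sigma j (b i).
Definition coord_mx b : 'M[rat]_n := \matrix_(i, j) coord (vbasis {:k}) j (b i).
Definition trace_form b : 'M[rat]_n := \matrix_(i, j) field_trace (b i * b j).

Lemma embed_mx_lincomb (b b' : 'I_n -> k) (Q : 'M[rat]_n) :
  (forall i, b' i = \sum_j Q i j *: b j) ->
  embed_mx b' = map_mx ratr Q *m embed_mx b.
Proof.
move=> eqb; apply/matrixP => i l; rewrite !mxE eqb rmorph_sum /=.
by apply: eq_bigr => j _; rewrite !mxE rmorphZ_num.
Qed.

Lemma embed_mx_coord b : embed_mx b = map_mx ratr (coord_mx b) *m embed_mx e.
Proof.
apply: embed_mx_lincomb => i; rewrite [LHS](coord_vbasis (memvf _)).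
by apply: eq_bigr => j _; rewrite mxE.
Qed.

(** The embedding matrix of the powers of [theta] is a Vandermonde matrix with distinct nodes, and
    it factors through the one of the basis [e]. *)
Lemma embed_vbasis_unit : embed_mx e \in unitmx.
Proof.
rewrite unitmxE unitfE.
pose t : 'rV[C]_n := \row_j sigma j theta.
have : \det (Vandermonde n t) != 0.
  rewrite det_Vandermonde; apply/prodf_neq0 => i _; apply/prodf_neq0 => j ltij.
  rewrite !mxE subr_eq0; apply: contraTneq ltij => /sigma_inj ->.
  by rewrite ltnn.
have -> : Vandermonde n t = embed_mx (fun i => theta ^+ i).
  by apply/matrixP => i j; rewrite !mxE rmorphXn.
by rewrite embed_mx_coord det_mulmx mulf_eq0 => /norP[].
Qed.

(** The embedding matrix of [e] diagonalises multiplication by [x], with the conjugates of [x] as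
    eigenvalues. *)
Lemma ratr_field_trace x : ratr (field_trace x) = \sum_l sigma l x.
Proof.
rewrite /field_trace; set M := \matrix_(i, j) _.
have ME : map_mx ratr M *m embed_mx e = embed_mx e *m diag_mx (\row_l sigma l x).
  rewrite -(@embed_mx_lincomb e (fun i => x * e i)); last first.
    move=> i; rewrite [LHS](coord_vbasis (memvf _)).
    by apply: eq_bigr => j _; rewrite mxE.
  by apply/matrixP => i l; rewrite mul_mx_diag !mxE rmorphM mulrC.
rewrite -trace_map_mx -[map_mx _ _](mulmxK embed_vbasis_unit) ME mxtrace_mulC.
rewrite mulmxA mulVmx ?embed_vbasis_unit // mul1mx mxtrace_diag.
by apply: eq_bigr => l _; rewrite mxE.
Qed.

Lemma embed_trace_form b :
  map_mx ratr (trace_form b) = embed_mx b *m (embed_mx b)^T.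
Proof.
apply/matrixP => i j; rewrite !mxE ratr_field_trace.
by apply: eq_bigr => l _; rewrite !mxE rmorphM.
Qed.

Lemma ratr_disc b : ratr (\det (trace_form b)) = \det (embed_mx b) ^+ 2.
Proof. by rewrite -det_map_mx embed_trace_form det_mulmx det_tr expr2. Qed.

Lemma integral_embed (x : k) l : alg_integer x -> integralOver (intr : int -> C) (sigma l x).
Proof.
case=> p monp rx; exists p => //.
rewrite (_ : map_poly _ p = map_poly (sigma l) (map_poly intr p)) ?fmorph_root //.
by rewrite -map_poly_comp; apply: eq_map_poly => a /=; rewrite rmorph_int.
Qed.

Lemma integral_trace (x : k) : alg_integer x -> exists m : int, field_trace x = m%:~R.
Proof.
move=> intx; apply: (@rat_integral_int C ratr); rewrite /= ratr_field_trace.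
apply: (big_ind (integralOver (intr : int -> C))) => [|u v|l _].
- exact: mxpoly.integral0.
- exact: integral_add.
exact: integral_embed.
Qed.

Lemma integral_disc b : (forall i, alg_integer (b i)) ->
  exists m : int, \det (trace_form b) = m%:~R.
Proof.
move=> intb.
have /choice[Z defZ] : forall ij : 'I_n * 'I_n, exists m : int,
    field_trace (b ij.1 * b ij.2) = m%:~R.
  by move=> ij; apply: integral_trace; apply: integral_mul; apply: intb.
exists (\det (\matrix_(i, j) Z (i, j))).
rewrite -det_map_mx; congr (\det _).
by apply/matrixP => i j; rewrite !mxE (defZ (i, j)).
Qed.

Lemma independent_basis b (c : 'I_n -> rat) : \det (embed_mx b) != 0 ->
  \sum_i c i *: b i = 0 -> forall i, c i = 0.
Proof.
move=> nzb sum0 i; pose v : 'rV[rat]_n := \row_j c j.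
have v0 : map_mx ratr v *m embed_mx b = 0.
  apply/matrixP => a l; rewrite !mxE.
  transitivity (sigma l (\sum_i c i *: b i)); last by rewrite sum0 rmorph0.
  rewrite rmorph_sum.
  by apply: eq_bigr => j _; rewrite !mxE rmorphZ_num.
have ub : embed_mx b \in unitmx by rewrite unitmxE unitfE.
have : map_mx (ratr : rat -> C) v = 0 by rewrite -[LHS](mulmxK ub) v0 mul0mx.
by move/eqP; rewrite map_mx_eq0 => /eqP/matrixP/(_ ord0 i); rewrite !mxE.
Qed.

Lemma spanning_basis b x : \det (embed_mx b) != 0 ->
  exists c : 'I_n -> rat, x = \sum_i c i *: b i.
Proof.
rewrite embed_mx_coord det_mulmx mulf_eq0 => /norP[nzc _].
have uc : coord_mx b \in unitmx.
  by rewrite unitmxE unitfE -(fmorph_eq0 (ratr : rat -> C)) -det_map_mx.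
pose v : 'rV[rat]_n := \row_j coord (vbasis {:k}) j x.
exists (fun i => (v *m invmx (coord_mx b)) ord0 i).
have -> : \sum_i (v *m invmx (coord_mx b)) ord0 i *: b i =
   \sum_j (v *m invmx (coord_mx b) *m coord_mx b) ord0 j *: e j.
  under [RHS]eq_bigr => j _ do rewrite [(_ *m coord_mx b) _ _]mxE scaler_suml.
  rewrite exchange_big; apply: eq_bigr => i _ /=.
  rewrite [in LHS](coord_vbasis (memvf (b i))) scaler_sumr.
  by apply: eq_bigr => j _; rewrite scalerA [coord_mx b i j]mxE.
rewrite mulmxKV // [LHS](coord_vbasis (memvf x)).
by apply: eq_bigr => j _; rewrite mxE.
Qed.

Lemma det_replace_row (K : comNzRingType) m (i0 : 'I_m) (v : 'I_m -> K) :
  \det (\matrix_(i, j) if i == i0 then v j else (i == j)%:R) = v i0.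
Proof.
rewrite (expand_det_col _ i0) (bigD1 i0) //= big1 ?addr0; last first.
  by move=> i /negbTE nei; rewrite mxE nei mul0r.
rewrite mxE eqxx /cofactor -signr_odd addnn odd_double mul1r.
rewrite (_ : row' _ _ = 1%:M) ?det1 ?mulr1 //.
apply/matrixP => i j; rewrite !mxE eq_sym (negbTE (neq_lift _ _)).
by rewrite (inj_eq lift_inj).
Qed.

Lemma exists_integral_vbasis :
  exists2 b, forall i, alg_integer (b i) & \det (embed_mx b) != 0.
Proof.
have /choice[N defN] : forall i : 'I_n, exists N : int, N != 0 /\ alg_integer (e i *~ N).
  by move=> i; have [N nzN intN] := integral_multiple (e i); exists N.
exists (fun i => e i *~ N i) => [i|]; first by have [] := defN i.
rewrite (_ : embed_mx _ = diag_mx (\row_i (N i)%:~R) *m embed_mx e); last first.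
  apply/matrixP => i l; rewrite mul_diag_mx !mxE -mulrzl rmorphM rmorph_int //.
rewrite det_mulmx det_diag mulf_neq0 //; last by rewrite -unitfE -unitmxE embed_vbasis_unit.
by apply/prodf_neq0 => i _; rewrite mxE intr_eq0; have [] := defN i.
Qed.

(** The family [b] expresses, through an integer matrix, integers [b'] whose embedding matrix is
    invertible. *)
Lemma integral_basis_det b : integral_basis b -> \det (embed_mx b) != 0.
Proof.
case=> intb spanb; have [b' intb' nzb'] := exists_integral_vbasis.
have /choice[Z defZ] : forall i : 'I_n, exists z : {ffun 'I_n -> int}, b' i = \sum_j b j *~ z j.
  by move=> i; have [z [defz _]] := spanb _ (intb' i); exists z.
move: nzb'; rewrite (@embed_mx_lincomb b b' (\matrix_(i, j) (Z i j)%:~R)); last first.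
  move=> i; rewrite defZ; apply: eq_bigr => j _.
  by rewrite mxE -mulr_algl alg_num_field ratr_int mulrzl.
by rewrite det_mulmx mulf_eq0 => /norP[].
Qed.

(* Among the integral bases of the rational vector space [k], one of minimal
   discriminant generates all integers: a fractional coordinate [f] could be
   used to multiply the discriminant by [f ^ 2 < 1]. *)
Lemma exists_integral_basis : exists b : 'I_n -> k, integral_basis b.
Proof.
pose P (N : nat) := exists b, [/\ forall i, alg_integer (b i), \det (embed_mx b) != 0
  & `|\det (trace_form b)| = N%:R].
have exP : exists N, `[< P N >].
  have [b intb nzb] := exists_integral_vbasis; have [m defm] := integral_disc intb.
  exists `|m|%N; apply/asboolP; exists b; split=> //.
  by rewrite defm -intr_norm -abszE.
case: (ex_minnP exP) => N /asboolP[b [intb nzb defN]] minN.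
exists b; split=> // x intx; have [c defx] := spanning_basis x nzb.
have int_c i0 : exists m : int, c i0 = m%:~R.
  pose f := c i0 - (Num.floor (c i0))%:~R.
  have f_ge0 : 0 <= f by rewrite subr_ge0 floor_le.
  have f_lt1 : f < 1 by have := floorD1_gt (c i0); rewrite intrD /f; lra.
  have [f0|nzf] := eqVneq f 0; first by exists (Num.floor (c i0)); apply: subr0_eq.
  pose v j := if j == i0 then f else c j.
  pose T : 'M[rat]_n := \matrix_(i, j) if i == i0 then v j else (i == j)%:R.
  (* The new [i0]-th vector is an integer of [k] whose [i0]-th coordinate is the fractional part
     [f], so the embedding determinant is multiplied by [f]. *)
  pose b' i := if i == i0 then x - b i0 *~ Num.floor (c i0) else b i.
  have eb' : embed_mx b' = map_mx ratr T *m embed_mx b.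
    apply: embed_mx_lincomb => i; rewrite /b'.
    have [->|nei] := eqVneq i i0.
      rewrite defx (bigD1 i0) //= [RHS](bigD1 i0) //= !mxE eqxx /v eqxx.
      rewrite scalerBl scaler_int addrAC; congr (_ + _).
      by apply: eq_bigr => j /negbTE nej; rewrite mxE eqxx /v nej.
    rewrite (bigD1 i) //= mxE (negbTE nei) eqxx scale1r big1 ?addr0 // => j nej.
    by rewrite mxE (negbTE nei) eq_sym (negbTE nej) scale0r.
  have detb' : \det (embed_mx b') = ratr f * \det (embed_mx b).
    by rewrite eb' det_mulmx det_map_mx det_replace_row /v eqxx.
  have nzb' : \det (embed_mx b') != 0 by rewrite detb' mulf_neq0 // fmorph_eq0.
  have intb' i : alg_integer (b' i).
    rewrite /b'; case: eqP => _; last exact: intb.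
    rewrite -mulrzl; apply: integral_sub; first exact: intx.
    by apply: integral_mul; [exact: integral_id | exact: intb].
  have discb' : \det (trace_form b') = f ^+ 2 * \det (trace_form b).
    apply: (fmorph_inj (ratr : {rmorphism rat -> C})).
    by rewrite rmorphM rmorphXn /= !ratr_disc detb' exprMn.
  have [m defm] := integral_disc intb'.
  have absm : `|\det (trace_form b')| = `|m|%N%:R by rewrite defm -intr_norm -abszE.
  have leN : (N <= `|m|)%N by apply: minN; apply/asboolP; exists b'.
  have : N%:R <= f ^+ 2 * N%:R :> rat.
    rewrite -defN -(ger0_norm (sqr_ge0 f)) -normrM -discb' absm defN.
    by rewrite ler_nat.
  have N0 : 0 < N%:R :> rat.
    rewrite -defN normr_gt0 -(fmorph_eq0 (ratr : {rmorphism rat -> C})) /= ratr_disc.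
    by rewrite expf_neq0.
  by have : f ^+ 2 < 1; [rewrite expr2; nra | nra].
have [m defm] := choice int_c.
have castz (z : int) u : u *~ z = (z%:~R : rat) *: u :> k by rewrite scaler_int.
exists [ffun i => m i]; split.
  by rewrite defx; apply: eq_bigr => i _; rewrite ffunE castz defm.
move=> z defz; apply/ffunP => i; rewrite ffunE; apply/eqP.
rewrite -(eqr_int rat) -defm -subr_eq0; apply/eqP.
apply: (@independent_basis b (fun i => c i - (z i)%:~R)) => //.
under eq_bigr do rewrite scalerBl -castz.
by rewrite sumrB -defx -defz subrr.
Qed.

End Lattice.

(** * Absolute values *)

Import ComplexField.Normc.

Section AbsoluteValues.
Variables (R : realType) (F : fieldType) (v : F -> R).
Hypothesis absv : absolute_value v.

Let v_ge0 x : 0 <= v x. Proof. by case: absv. Qed.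
Let vM x y : v (x * y) = v x * v y. Proof. by case: absv. Qed.
Let v0 : v 0 = 0. Proof. by case: absv => _ h _ _; apply/h. Qed.

Lemma absv1 : v 1 = 1.
Proof.
have nz : v 1 != 0.
  by apply/eqP; case: absv => _ h _ _ /h /eqP; rewrite oner_eq0.
by apply: (mulfI nz); rewrite -vM !mulr1.
Qed.

Lemma absvX x m : v (x ^+ m) = v x ^+ m.
Proof. by elim: m => [|m IH]; rewrite ?expr0 ?absv1 // !exprS vM IH. Qed.

Lemma absvN1 : v (-1) = 1.
Proof.
apply/eqP; rewrite -(@eqrXn2 _ 2) ?v_ge0 ?ler01 // -absvX sqrrN expr1n absv1.
by rewrite expr1n.
Qed.

Lemma absvB x y : v x - v y <= v (x - y).
Proof. by case: absv => _ _ _ h; have := h (x - y) y; rewrite subrK; lra. Qed.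

Lemma absvC x y : v (x - y) = v (y - x).
Proof. by rewrite -opprB -mulN1r vM absvN1 mul1r. Qed.

Lemma absv_sum (I : finType) (f : I -> F) : v (\sum_i f i) <= \sum_i v (f i).
Proof.
apply: (big_ind2 (fun a b => v a <= b)) => // [|a b c d ab cd]; first by rewrite v0.
by case: absv => _ _ _ h; apply: le_trans (h _ _) (lerD ab cd).
Qed.
End AbsoluteValues.

(** By Bernoulli's inequality [1 + m (t - 1) <= t^m]. *)
Lemma exprn_unbounded (R : realType) (t K : R) : 1 < t -> exists m, K < t ^+ m.
Proof.
move=> t1; have [m lt_m] : exists m : nat, K / (t - 1) < m%:R.
  by exists (Num.truncn (K / (t - 1))).+1; apply: truncnS_gt.
exists m; have : 1 + m%:R * (t - 1) <= t ^+ m.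
  elim: m {lt_m} => [|m IH]; first by rewrite mul0r addr0 expr0.
  have t0 : 0 <= t by lra.
  have := ler_wpM2l t0 IH; rewrite -exprS -natr1.
  by have := mulr_ge0 (ler0n R m) (sqr_ge0 (t - 1)); lra.
move: lt_m; rewrite ltr_pdivrMr ?subr_gt0 //; lra.
Qed.

(* Tensor-power trick. *)
Lemma le_of_le_exprn (R : realType) (t u K : R) : 0 <= u ->
  (forall m, t ^+ m <= K * u ^+ m) -> t <= u.
Proof.
move=> u0 h; rewrite leNgt; apply/negP => ltut.
have := u0; rewrite le_eqVlt => /orP[/eqP u_eq0|u_gt0].
  by have := h 1%N; rewrite !expr1 -u_eq0 mulr0; lra.
have tu : 1 < t / u by rewrite ltr_pdivlMr // mul1r.
have [m] := exprn_unbounded K tu.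
by rewrite ltNge expr_div_n ler_pdivrMr ?exprn_gt0 // h.
Qed.

(** * Places at which a given integer is large *)

Section Places.
Variables (R : realType) (k : fieldExtType rat).
Local Notation C := R[i].
Local Notation n := (\dim {:k}).
Variables (theta : k) (sigma : 'I_n -> {rmorphism k -> C}).
Hypothesis sigma_inj : injective (fun i => sigma i theta).
Variable b : 'I_n -> k.
Hypothesis intb : integral_basis b.
Implicit Types (v : k -> R) (x alpha : k).

(** All powers of [alpha] have integer coordinates in [b], so their absolute values stay bounded.
    Boundedness of the powers stands in for the ultrametric inequality, which [absolute_value] does
    not include. *)
Lemma padic_place_le1 v p alpha : absolute_value v -> prime p ->
  extends_padic p v -> alg_integer alpha -> v alpha <= 1.
Proof.
move=> absv pr_p vp inta.
apply: (@le_of_le_exprn _ _ _ (\sum_i v (b i))) => // m; rewrite expr1n mulr1.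
have intm : alg_integer (alpha ^+ m).
  elim: m => [|m IH]; first by rewrite expr0; apply: integral1.
  by rewrite exprS; apply: integral_mul.
have [_ /(_ _ intm)[z [defz _]]] := intb.
rewrite -(absvX absv) defz; apply: le_trans (absv_sum absv _) _.
apply: ler_sum => i _; rewrite -mulrzl -ratr_int -alg_num_field.
have [v_ge0 _ vM _] := absv; rewrite vM ler_piMl // vp /padic_abs.
case: eqP => // _; rewrite denq_int logn1 sub0r numq_int.
rewrite -exprz_inv exprn_ile1 ?invr_ge0 // invf_le1 ?ler1n ?ltr0n ?prime_gt0 //.
Qed.

Definition total_norm x : R := \sum_i normc (sigma i x).

Lemma normc_ge0 (z : C) : 0 <= normc z.
Proof. by case: z => x y; rewrite sqrtr_ge0. Qed.

Lemma normc_abs : absolute_value (@normc R).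
Proof.
split; [exact: normc_ge0| |exact: normcM|exact: le_normcD].
by move=> x; split=> [/eq0_normc//|->]; rewrite normc0.
Qed.

Lemma normcX (z : C) m : normc (z ^+ m) = normc z ^+ m.
Proof. exact: absvX normc_abs _ _. Qed.

Lemma ratr_complex (q : rat) : ratr q = (ratr q : R)%:C%C :> C.
Proof. exact/esym/(fmorph_rat (@real_complex_def R (Phant R) : {rmorphism R -> C})). Qed.

Lemma normc_ratr (q : rat) : normc (ratr q : C) = `|ratr q|.
Proof.
by rewrite ratr_complex /= expr0n addr0 sqrtr_sqr.
Qed.

(* The coordinates of [x] in [b] are linear forms in the conjugates of [x]. *)
Lemma archimedean_le v : absolute_value v -> extends_archimedean v ->
  exists2 K, 0 <= K & forall x, v x <= K * total_norm x.
Proof.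
move=> absv va; have nzb := integral_basis_det sigma_inj intb.
have ub : embed_mx sigma b \in unitmx by rewrite unitmxE unitfE.
have [v_ge0 _ vM _] := absv.
pose W := invmx (embed_mx sigma b).
pose K := \sum_i v (b i) * \sum_l normc (W l i).
have K1_ge0 i : 0 <= \sum_l normc (W l i) by rewrite sumr_ge0 // => l _; apply: normc_ge0.
have K_ge0 : 0 <= K by rewrite sumr_ge0 // => i _; rewrite mulr_ge0.
exists K => // x; have [c defx] := spanning_basis x nzb.
have cE i : ratr (c i) = \sum_l sigma l x * W l i :> C.
  have : map_mx ratr (\row_j c j) = (\row_l sigma l x) *m W.
    rewrite -[LHS](mulmxK ub); congr (_ *m _); apply/matrixP => a l.
    rewrite !mxE defx rmorph_sum; apply: eq_bigr => j _.
    by rewrite !mxE rmorphZ_num.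
  move/matrixP/(_ ord0 i); rewrite !mxE => ->.
  by apply: eq_bigr => l _; rewrite mxE.
have le_tot l : normc (sigma l x) <= total_norm x.
  by rewrite /total_norm (bigD1 l) //= lerDl sumr_ge0 // => j _; apply: normc_ge0.
rewrite {1}defx mulr_suml; apply: le_trans (absv_sum absv _) _.
apply: ler_sum => i _; rewrite -mulr_algl vM va mulrC -mulrA ler_wpM2l //.
rewrite -normc_ratr cE mulr_suml; apply: le_trans (absv_sum normc_abs _) _.
by apply: ler_sum => l _; rewrite normcM mulrC ler_wpM2l ?normc_ge0.
Qed.

Variables (i0 : 'I_n) (alpha : k).
Hypothesis real0 : forall x, complex.Im (sigma i0 x) = 0.
Hypothesis other_le1 : forall i, i != i0 -> normc (sigma i alpha) <= 1.
Let v0 x := normc (sigma i0 x).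
Let a := v0 alpha.
Hypothesis a_ge1 : 1 <= a.

Let real0E x : v0 x = `|complex.Re (sigma i0 x)|.
Proof.
by rewrite /v0; case: (sigma i0 x) (real0 x) => y z /= ->; rewrite expr0n addr0 sqrtr_sqr.
Qed.

(** Only the conjugate at [i0] can grow with [m]; the other ones are multiplied by numbers of
    absolute value at most 1. *)
Lemma total_norm_le x m :
  total_norm (x * alpha ^+ m) <= v0 x * a ^+ m + total_norm x.
Proof.
rewrite /total_norm (bigD1 i0) //= rmorphM rmorphXn normcM normcX lerD //.
rewrite [leRHS](bigD1 i0) //= -[leLHS]add0r lerD ?normc_ge0 //.
apply: ler_sum => i nei; rewrite rmorphM rmorphXn normcM normcX.
by rewrite ler_piMr ?normc_ge0 // exprn_ile1 ?normc_ge0 ?other_le1.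
Qed.

Lemma exists_rat_near (x : R) (e : R) : 0 < e -> exists q : rat, `|x - ratr q| < e.
Proof.
move=> e0; have [q] := @rat_in_itvoo R (x - e) (x + e) (ltac:(lra)).
by rewrite in_itv /= => /andP[h1 h2]; exists q; rewrite ltr_distl; apply/andP; split; lra.
Qed.

(** Everything follows from [leKm], the bound of [archimedean_le] at [x alpha^m], as [m] grows:
    first [v alpha = a], then [v <= K v0], then [v <= v0] by taking powers, and equality by taking
    inverses. *)
Lemma archimedean_place_eq v : absolute_value v -> extends_archimedean v ->
  1 < v alpha -> v = v0.
Proof.
move=> absv va va1; have [v_ge0 vz vM vD] := absv.
have [K K0 leK] := archimedean_le absv va.
have leKm x m : v x * v alpha ^+ m <= K * (v0 x * a ^+ m + total_norm x).
  rewrite -(absvX absv) -vM; apply: le_trans (leK _) _.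
  by rewrite ler_wpM2l // total_norm_le.
have va_a : v alpha <= a.
  apply: (@le_of_le_exprn _ _ _ (K * (1 + total_norm 1))) => [|m].
    exact: le_trans a_ge1.
  have := leKm 1 m; rewrite (absv1 absv) mul1r => h; apply: (le_trans h).
  rewrite -mulrA ler_wpM2l // mulrDl /v0 rmorph1 normc1 mul1r lerD2l.
  rewrite ler_peMr ?exprn_ege1 // sumr_ge0 // => i _; exact: normc_ge0.
have a_va : a <= v alpha.
  (* A rational [q] is sought that is close to [alpha] both in the real embedding and for [v], since
     [v q = |q|]. Closeness for [v] comes from [leKm] at [alpha - q], divided by a large power of
     [v alpha]. *)
  apply/ler_addgt0Pr => e e0.
  pose S := total_norm alpha + \sum_(i < n) (a + 1).
  have S0 : 0 <= S.
    rewrite addr_ge0 // sumr_ge0 // => i _; rewrite ?normc_ge0 //.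
    by rewrite addr_ge0 // normc_ge0.
  have [m lt_m] := exprn_unbounded (2 * (K * (1 + S)) / e) va1.
  have am0 : 0 < a ^+ m by rewrite exprn_gt0 // (lt_le_trans ltr01).
  (* The bound 1 keeps [|q| <= a + 1], so that [S] bounds the total norm of [alpha - q]; the bound
     [(a ^+ m)^-1] keeps [v0 (alpha - q) a^m <= 1]; [e / 2] serves in the final estimate. *)
  pose d := Num.min (e / 2) (Num.min 1 (a ^+ m)^-1).
  have d0 : 0 < d by rewrite !lt_min divr_gt0 //= ltr01 invr_gt0.
  have [q lt_q] := exists_rat_near (complex.Re (sigma i0 alpha)) d0.
  have v0q : v0 (alpha - q%:A) = `|complex.Re (sigma i0 alpha) - ratr q|.
    rewrite real0E rmorphB /= rmorphZ_num rmorph1 mulr1 ratr_complex.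
    by case: (sigma i0 alpha).
  have aE : a = `|complex.Re (sigma i0 alpha)| by exact: real0E.
  have [dle1 dlea dlee] : [/\ d <= 1, d <= (a ^+ m)^-1 & d <= e / 2].
    by rewrite /d !ge_min !lexx !orbT.
  have q_le : `|ratr q : R| <= a + 1.
    rewrite aE; have := ler_normB (complex.Re (sigma i0 alpha)) (complex.Re (sigma i0 alpha) - ratr q).
    by rewrite opprB addrCA subrr addr0; lra.
  have tot_le : total_norm (alpha - q%:A) <= S.
    rewrite /S /total_norm -big_split /=; apply: ler_sum => i _.
    rewrite rmorphB /= rmorphZ_num rmorph1 mulr1.
    have [_ _ _ tri] := normc_abs; apply: le_trans (tri _ _) _.
    rewrite lerD2l -[- ratr q]mulN1r normcM (absvN1 normc_abs) mul1r normc_ratr //.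
  have small : v (alpha - q%:A) < e / 2.
    have vam0 : 0 < v alpha ^+ m by rewrite exprn_gt0 // (lt_trans ltr01).
    rewrite -(ltr_pM2r vam0).
    have h1 := leKm (alpha - q%:A) m.
    have h2 : v0 (alpha - q%:A) * a ^+ m <= 1.
      by rewrite v0q -ler_pdivlMr // div1r; lra.
    have h3 : K * (v0 (alpha - q%:A) * a ^+ m + total_norm (alpha - q%:A)) <= K * (1 + S).
      by rewrite ler_wpM2l // lerD.
    move: lt_m; rewrite ltr_pdivrMr // => h4; lra.
  have := absvB absv q%:A alpha; rewrite (absvC absv) va => h5.
  have := ler_normD (ratr q : R) (complex.Re (sigma i0 alpha) - ratr q).
  by rewrite addrC subrK -aE; lra.
have eq_a : v alpha = a by apply/eqP; rewrite eq_le va_a.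
have le_Kv x : v x <= K * v0 x.
  apply/ler_addgt0Pr => e e0.
  have [m lt_m] := exprn_unbounded (K * total_norm x / e) va1.
  have am0 : 0 < a ^+ m by rewrite exprn_gt0 // (lt_le_trans ltr01).
  have := leKm x m; rewrite eq_a => h; rewrite -(ler_pM2r am0).
  apply: (le_trans h); rewrite mulrDr mulrDl mulrA lerD2l.
  by move: lt_m; rewrite eq_a ltr_pdivrMr // [_ * e]mulrC => /ltW.
have le_v x : v x <= v0 x.
  apply: (@le_of_le_exprn _ _ _ K) => [|m]; first exact: normc_ge0.
  by rewrite -(absvX absv) /v0 -normcX -rmorphXn le_Kv.
apply/funext => x; apply/eqP; rewrite eq_le le_v /=.
have [->|nzx] := eqVneq x 0; first by rewrite /v0 rmorph0 normc0.
have v1 : v x * v x^-1 = 1 by rewrite -vM mulfV // (absv1 absv).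
have v01 : v0 x * v0 x^-1 = 1.
  by rewrite /v0 -normcM -rmorphM mulfV // rmorph1 normc1.
rewrite -[leLHS]mulr1 -v1 mulrCA -[leRHS]mulr1 -v01 ler_wpM2l //.
by rewrite ler_wpM2l ?normc_ge0.
Qed.

End Places.

(** * Minkowski's theorem with a closed condition at one index *)

(** For every [T' > T] the open version, with row [i0] divided by [T'], yields a point of value
    below [T']. Only finitely many candidates have value below [T + 1], so one of them has least
    value, and this cannot exceed [T]. *)
Theorem minkowski_body_closed (R : realType) (n : nat) (c : 'I_n -> 'I_n)
    (pos : pred 'I_n) (cK : involutive c)
    (pos_real : forall i, c i = i -> ~~ pos i)
    (pos_conj : forall i, c i != i -> pos (c i) = ~~ pos i)
    (A : 'M[R]_n) (i0 : 'I_n) (T : R) :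
  c i0 = i0 -> \det A != 0 -> 0 < T ->
  2 ^+ n * `|\det A| <=
    T * \prod_i (if c i == i then 2 else if pos i then pi else 1) ->
  exists z : 'cV[int]_n, [/\ z != 0, `|(A *m map_mx intr z) i0 ord0| <= T,
    forall i, i != i0 -> c i = i -> `|(A *m map_mx intr z) i ord0| < 1
  & forall i, pos i -> (A *m map_mx intr z) i ord0 ^+ 2 +
                       (A *m map_mx intr z) (c i) ord0 ^+ 2 < 1].
Proof.
move=> ci0 nzA T0 leT.
pose P (z : 'cV[int]_n) := [/\ z != 0,
    forall i, i != i0 -> c i = i -> `|(A *m map_mx intr z) i ord0| < 1
  & forall i, pos i -> (A *m map_mx intr z) i ord0 ^+ 2 +
                       (A *m map_mx intr z) (c i) ord0 ^+ 2 < 1].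
pose val (z : 'cV[int]_n) : R := `|(A *m map_mx intr z) i0 ord0|.
have open_case T' : T < T' -> exists z, P z /\ val z < T'.
  move=> TT'; have T'0 : 0 < T' by apply: lt_trans TT'.
  pose t : 'rV[R]_n := \row_i if i == i0 then T'^-1 else 1.
  have dett : \det (diag_mx t) = T'^-1.
    rewrite det_diag (bigD1 i0) //= mxE eqxx big1 ?mulr1 // => i /negbTE nei.
    by rewrite mxE nei.
  have := @minkowski_body R n c pos cK pos_real pos_conj (diag_mx t *m A).
  rewrite det_mulmx dett normrM mulf_neq0 ?invr_neq0 ?(gt_eqF T'0) // => /(_ isT).
  set Q := \prod_i _ in leT *.
  have Q0 : 0 < Q.
    by apply: prodr_gt0 => i _; case: ifP => // _; case: ifP => // _; apply: pi_gt0.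
  case.
    rewrite ger0_norm ?invr_ge0 ?(ltW T'0) // mulrCA mulrC ltr_pdivrMr //.
    by apply: le_lt_trans leT _; rewrite mulrC ltr_pM2l.
  have rowE z i : (diag_mx t *m A *m map_mx intr z) i ord0 = t ord0 i * (A *m map_mx intr z) i ord0.
    by rewrite -mulmxA mul_diag_mx mxE.
  move=> z [nz0 hr hp]; exists z; split; last first.
    have := hr i0 ci0; rewrite rowE [t _ _]mxE eqxx normrM normfV (ger0_norm (ltW T'0)).
    by rewrite ltr_pdivrMl // mulr1.
  split=> // i.
    by move=> nei ci; have := hr i ci; rewrite rowE [t _ _]mxE (negbTE nei) mul1r.
  (* A [pos] index and its conjugate both differ from the fixed index [i0], so neither row was
     scaled. *)
  move=> ip; have nei j : pos j || pos (c j) -> j != i0.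
    by apply: contraTneq => ->; rewrite ci0 orbb pos_real.
  have := hp i ip; rewrite !rowE [t _ i]mxE [t _ (c i)]mxE.
  by rewrite !(negbTE (nei _ _)) ?cK ?ip ?orbT // !mul1r.
have uA : A \in unitmx by rewrite unitmxE unitfE.
pose K := \sum_j \sum_i `|invmx A j i| * (T + 2).
have bounded z j : P z -> val z < T + 1 -> `|(z j ord0)%:~R| <= K :> R.
  case=> _ hr hp hv.
  have wb i : `|(A *m map_mx intr z) i ord0| <= T + 2.
    have sq (x y : R) : x ^+ 2 + y ^+ 2 < 1 -> `|x| <= T + 2.
      move=> h; apply: (@le_trans _ _ 1); last by lra.
      by rewrite -(@expr_le1 _ 2) // real_normK ?num_real //; have := sqr_ge0 y; lra.
    have [->|nei] := eqVneq i i0; first by move: hv; rewrite /val; lra.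
    have [ci|ci] := eqVneq (c i) i; first by have := hr i nei ci; lra.
    case ip : (pos i); first exact: sq (hp i ip).
    by apply: (sq _ ((A *m map_mx intr z) (c i) ord0)); rewrite addrC -{2}(cK i) hp // pos_conj // ip.
  have -> : (z j ord0)%:~R = \sum_i invmx A j i * (A *m map_mx intr z) i ord0.
    have -> : (z j ord0)%:~R = (invmx A *m (A *m map_mx intr z)) j ord0 by rewrite mulKmx // mxE.
    by rewrite mxE.
  apply: le_trans (ler_norm_sum _ _ _) _; rewrite /K [leRHS](bigD1 j) //= -[leLHS]addr0.
  apply: lerD; last by apply: sumr_ge0 => i _; apply: sumr_ge0 => l _; rewrite mulr_ge0 //; lra.
  by apply: ler_sum => i _; rewrite normrM ler_wpM2l.
pose N := (Num.truncn K).+1.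
(* Signs and absolute values code all candidates of value below [T + 1] in a finite type, on which a
   minimum can be taken. *)
pose dec (f : {ffun 'I_n -> bool * 'I_N}) : 'cV[int]_n :=
  \col_j if (f j).1 then (f j).2%:Z else - (f j).2%:Z.
have dec_surj z : P z -> val z < T + 1 -> exists f, dec f = z.
  move=> Pz vz.
  have ltN j : (`|z j ord0| < N)%N.
    have h := bounded z j Pz vz.
    by rewrite /N ltnS truncn_ge_nat ?(le_trans _ h) // natr_absz intr_norm.
  exists [ffun j => (0 <= z j ord0, Ordinal (ltN j))]; apply/matrixP => j o.
  rewrite (ord1 o) !mxE ffunE /=; case: (z j ord0) => m //=.
have [z1 [Pz1 vz1]] := open_case (T + 1) (ltac:(lra)).
have [f1 deff1] := dec_surj z1 Pz1 vz1.
pose Pf f := `[< P (dec f) >].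
have Pf1 : Pf f1 by apply/asboolP; rewrite deff1.
case: (@Order.TotalTheory.arg_minP _ _ _ f1 Pf (fun f => val (dec f)) Pf1) => f /asboolP Pf' minf.
exists (dec f); have [h1 h2 h3] := Pf'; split=> //.
rewrite leNgt; apply/negP => ltT.
have [z [Pz]] := open_case (Num.min (val (dec f)) (T + 1)) (ltac:(by rewrite lt_min ltT ltrDl ltr01)).
rewrite lt_min => /andP[lt1 lt2]; have [g defg] := dec_surj z Pz lt2.
have := minf g; rewrite /Pf defg => /(_ (asboolT Pz)).
by rewrite leNgt lt1.
Qed.

(** The rationals are dense in the image of [tau], hence in the completion, so [rat_closure] is the
    whole field, and a field has dimension 1 over itself. The default value 0 of [xget] satisfies
    the bound too. *)
Lemma local_degree_real (R : realType) (k : fieldExtType rat) (v : k -> R)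
    (tau : {rmorphism k -> R}) :
  (forall x, v x = `|tau x|) -> (local_degree v <= 1)%N.
Proof.
move=> defv; rewrite /local_degree; case: xgetP => [m _ [Cv [u basis_u]]|//].
have [abs_ge0 _ absM absD] := comp_abs_valued Cv.
have closed y : rat_closure (C := Cv) y.
  move=> e e0; have e2 : 0 < e / 2 by rewrite divr_gt0.
  have [x lt_x] := comp_dense y e2.
  have [q lt_q] := exists_rat_near (tau x) e2.
  have dq : comp_abs (comp_emb Cv x - comp_emb Cv q%:A) = `|tau x - ratr q|.
    by rewrite -rmorphB comp_abs_emb defv rmorphB rmorphZ_num rmorph1 mulr1.
  exists q; have := absD (y - comp_emb Cv x) (comp_emb Cv x - comp_emb Cv q%:A).
  rewrite addrA subrK dq => h; apply: (le_lt_trans h).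
  by rewrite [ltRHS]splitr ltrD.
rewrite leqNgt; apply/negP => m1.
pose i0 : 'I_m := Ordinal (ltnW m1); pose i1 : 'I_m := Ordinal m1.
have [c [_ uniq_c]] := basis_u 0.
have rel (x y : comp_field Cv) : x * u i0 + y * u i1 = 0 ->
    c = [ffun i => if i == i0 then x else if i == i1 then y else 0].
  move=> xy0; apply: uniq_c; split=> [i|]; first exact: closed.
  rewrite (bigD1 i0) //= (bigD1 i1) //= big1 ?addr0 ?ffunE //= => i /andP[/negbTE n0 /negbTE n1].
  by rewrite ffunE n0 n1 mul0r.
have c0 : c = 0.
  rewrite (rel 0 0) ?mul0r ?addr0 //; apply/ffunP => i; rewrite !ffunE.
  by case: ifP => // _; case: ifP.
(* Two basis vectors satisfy [u i1 * u i0 - u i0 * u i1 = 0]. Uniqueness of coordinates forces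
   [u i0 = 0], and then the coefficients 1 and 0 give a second representation of 0. *)
have : u i0 = 0.
  have /rel : u i1 * u i0 + - u i0 * u i1 = 0 by ring.
  rewrite c0 => /ffunP/(_ i1); rewrite !ffunE /= => /esym/eqP.
  by rewrite oppr_eq0 => /eqP.
move=> u0; have /rel : 1 * u i0 + 0 * u i1 = 0 by rewrite u0; ring.
rewrite c0 => /ffunP/(_ i0); rewrite !ffunE /= => /esym/eqP.
by rewrite oner_eq0.
Qed.

(** * Generators and the signature *)

Section Generation.
Variables (R : realType) (k : fieldExtType rat).
Local Notation C := R[i].
Local Notation n := (\dim {:k}).
Variables (theta : k) (sigma : 'I_n -> {rmorphism k -> C}).
Hypothesis theta_gen : <<1%VS; theta>>%VS = fullv.
Hypothesis sigma_inj : injective (fun i => sigma i theta).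
Hypothesis sigma_surj : forall tau : {rmorphism k -> C}, exists i, tau =1 sigma i.

(* If [theta] had degree at least 2 over [rat(alpha)], a second root of its
   minimal polynomial there would give an embedding that agrees with
   [sigma i0] on [alpha]. *)
Lemma generates_of_conj_neq alpha i0 :
  (forall i, i != i0 -> sigma i alpha != sigma i0 alpha) ->
  <<1%VS; alpha>>%VS = fullv.
Proof.
move=> neq; pose K := <<1%AS; alpha>>%AS; pose m := minPoly K theta.
have [p [sepp monp szp rootp gen]] := rat_minPoly theta_gen.
suff szm : (size m <= 2)%N.
  have : theta \in K.
    have := root_minPoly K theta; rewrite -/m => rm.
    have deg1 : adjoin_degree K theta = 1%N.
      by apply/eqP; rewrite eqn_leq -ltnS -(size_minPoly K theta) szm /= /adjoin_degree.
    by rewrite -adjoin_deg_eq1 deg1.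
  move=> thK; apply/eqP; rewrite eqEsubv subvf -theta_gen.
  by apply/FadjoinP; split=> //; apply: sub1v.
rewrite leqNgt; apply/negP => szm.
pose m' := map_poly (sigma i0) m.
have rm' : root m' (sigma i0 theta) by rewrite fmorph_root root_minPoly.
have sepm' : separable_poly m'.
  rewrite separable_map; apply: pcharf0_separable => q.
  by rewrite (fmorph_pchar (in_alg k)) pchar_num.
(* The cofactor [g] is not constant, so it has a root [rho], distinct from [sigma i0 theta] by
   separability. *)
have /factor_theorem[g defg] := rm'.
have szg : size g != 1%N.
  apply: contraTneq szm => szg; rewrite -(size_map_poly (sigma i0)) -/m' defg.
  by rewrite size_Mmonic ?monicXsubC ?size_XsubC ?szg // -size_poly_eq0 szg.
have [rho rg] := closed_rootP g szg.
have rho_neq : rho != sigma i0 theta.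
  apply: contraTneq sepm' => e; rewrite defg separable_root negb_and negbK -e rg.
  by rewrite orbT.
have rm'rho : root m' rho by rewrite defg rootM rg.
have dvd_m q : q \is a polyOver K -> root q theta -> root (map_poly (sigma i0) q) rho.
  move=> Kq rq; have /dvdpP[u ->] : m' %| map_poly (sigma i0) q.
    by rewrite dvdp_map minPoly_dvdp.
  by rewrite rootM rm'rho orbT.
have ratK (q : {poly rat}) : map_poly (in_alg k) q \is a polyOver K.
  apply: (polyOverSv (sub1v K)); apply/polyOver1P; by exists q.
have mapr (q : {poly rat}) : map_poly (sigma i0) (map_poly (in_alg k) q) = map_poly ratr q.
  rewrite -map_poly_comp; apply: eq_map_poly => a /=.
  by rewrite alg_num_field fmorph_rat.
have [tau tau_th] : exists tau : {rmorphism k -> C}, tau theta = rho.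
  apply: (rmorph_of_root rootp gen); rewrite -mapr; apply: dvd_m => //.
  by rewrite rootp.
have [i tauE] := sigma_surj tau.
have nei : i != i0 by apply: contraNneq rho_neq => e; rewrite -tau_th tauE e.
have [q defq] := gen alpha.
case/negP: (neq i nei).
(* Writing [alpha = q(theta)], the polynomial [q - alpha] over [K] vanishes at [theta]; its image
   vanishes at [rho], which says that [tau alpha = sigma i0 alpha]. *)
have : root (map_poly (sigma i0) (map_poly (in_alg k) q - alpha%:P)) rho.
  apply: dvd_m; last by rewrite /root hornerD hornerN hornerC -defq subrr.
  by rewrite rpredB // polyOverC memv_adjoin.
rewrite rmorphB /= mapr map_polyC /root hornerD hornerN hornerC subr_eq0.
by rewrite -tau_th -rmorph_ratk -defq tauE.
Qed.

(** The product of the conjugates is the determinant of multiplication by [alpha] in the basis [b]: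
    an integer, and not zero. *)
Lemma norm_ge1 (b : 'I_n -> k) alpha : integral_basis b -> alg_integer alpha ->
  alpha != 0 -> 1 <= \prod_i normc (sigma i alpha).
Proof.
move=> intb inta nza; have nzb := integral_basis_det sigma_inj intb.
have [intbi span] := intb.
have /choice[Z defZ] : forall i : 'I_n, exists z : {ffun 'I_n -> int}, alpha * b i = \sum_j b j *~ z j.
  by move=> i; have [|z [defz _]] := span (alpha * b i); [by apply: integral_mul; [exact: inta | exact: intbi] | exists z].
have : embed_mx sigma b *m diag_mx (\row_l sigma l alpha) =
    map_mx ratr (\matrix_(i, j) (Z i j)%:~R) *m embed_mx sigma b.
  rewrite -(@embed_mx_lincomb _ _ sigma b (fun i => alpha * b i)) => [|i].
    by apply/matrixP => i l; rewrite mul_mx_diag !mxE rmorphM mulrC.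
  by rewrite defZ; apply: eq_bigr => j _; rewrite mxE scaler_int.
move/(congr1 determinant); rewrite !det_mulmx mulrC => /(mulIf nzb).
rewrite det_diag (_ : map_mx ratr _ = map_mx intr (\matrix_(i, j) Z i j)); last first.
  by apply/matrixP => i j; rewrite !mxE ratr_int.
rewrite det_map_mx /= => detE.
have normc_prod : normc (\prod_i sigma i alpha) = \prod_i normc (sigma i alpha).
  by apply: (big_morph (@normc R) (@normcM R)); apply: normc1.
have nzprod : \prod_i sigma i alpha != 0.
  by apply/prodf_neq0 => i _; rewrite fmorph_eq0.
have prodE : \prod_i (\row_l sigma l alpha) ord0 i = \prod_i sigma i alpha.
  by apply: eq_bigr => i _; rewrite mxE.
rewrite -normc_prod -prodE detE -ratr_int normc_ratr ratr_int -intr_norm.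
rewrite -prodE detE intr_eq0 in nzprod.
by rewrite -[1]/(1%:~R) ler_int -gtz0_ge1 normr_gt0.
Qed.

End Generation.

Lemma Re_sum (R : realType) (I : finType) (f : I -> R[i]) :
  complex.Re (\sum_i f i) = \sum_i complex.Re (f i).
Proof. by apply: (big_morph (@complex.Re R)) => // -[? ?] [? ?]. Qed.

Lemma Im_sum (R : realType) (I : finType) (f : I -> R[i]) :
  complex.Im (\sum_i f i) = \sum_i complex.Im (f i).
Proof. by apply: (big_morph (@complex.Im R)) => // -[? ?] [? ?]. Qed.

(** * Conjugate pairs of embeddings and the real lattice of integers *)

Section Signature.
Variables (R : realType) (k : fieldExtType rat).
Local Notation C := R[i].
Local Notation n := (\dim {:k}).
Variables (theta : k) (sigma : 'I_n -> {rmorphism k -> C}).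
Hypothesis sigma_inj : injective (fun i => sigma i theta).
Hypothesis sigma_surj : forall tau : {rmorphism k -> C}, exists i, tau =1 sigma i.

Lemma exists_conj : exists c : 'I_n -> 'I_n,
  forall i x, sigma (c i) x = conjc (sigma i x).
Proof.
have /choice[c defc] : forall i, exists j, forall x, conjc (sigma i x) = sigma j x.
  by move=> i; have [j defj] := sigma_surj (@conjc R \o sigma i); exists j.
by exists c => i x; rewrite defc.
Qed.

Variable c : 'I_n -> 'I_n.
Hypothesis conjE : forall i x, sigma (c i) x = conjc (sigma i x).

(** Testing at [theta] suffices: an embedding that is real at [theta] equals its conjugate. *)
Definition upper : pred 'I_n := fun i => 0 < complex.Im (sigma i theta).

Lemma conj_invol : involutive c.
Proof. by move=> i; apply: sigma_inj; rewrite /= !conjE conjcK. Qed.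

Lemma Im_conj i x : complex.Im (sigma (c i) x) = - complex.Im (sigma i x).
Proof. by rewrite conjE; case: (sigma i x). Qed.

Lemma Re_conj i x : complex.Re (sigma (c i) x) = complex.Re (sigma i x).
Proof. by rewrite conjE; case: (sigma i x). Qed.

Lemma normc_conj i x : normc (sigma (c i) x) = normc (sigma i x).
Proof. by rewrite conjE; case: (sigma i x) => a b /=; rewrite sqrrN. Qed.

Lemma conj_fixed_Im i x : c i = i -> complex.Im (sigma i x) = 0.
Proof. by move=> ci; have := Im_conj i x; rewrite ci; lra. Qed.

Lemma Im_theta_conj_fixed i : complex.Im (sigma i theta) = 0 -> c i = i.
Proof.
move=> im0; apply: sigma_inj; rewrite /= conjE.
by case: (sigma i theta) im0 => a b /= ->; rewrite oppr0.
Qed.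

Lemma upper_real i : c i = i -> ~~ upper i.
Proof. by move=> ci; rewrite /upper conj_fixed_Im // ltxx. Qed.

Lemma upper_conj i : c i != i -> upper (c i) = ~~ upper i.
Proof.
move=> ci; rewrite /upper Im_conj oppr_gt0 -leNgt lt_neqAle.
by rewrite (_ : (_ == 0) = false) //; apply: contraNF ci => /eqP/Im_theta_conj_fixed->.
Qed.

(** Every complex place comes from a non-real embedding, which may be replaced by its conjugate to
    make it [upper]. As [2 / pi <= 1], this inequality lets [s] replace [#|upper|] in the final
    bound. *)
Lemma card_complex_places :
  (#|` fset_set (@complex_places R k)| <= #|upper|)%N.
Proof.
pose s := [seq (fun x => normc (sigma i x)) | i <- enum upper].
rewrite cardE -(size_map (fun i x => normc (sigma i x))) -/s.
apply: uniq_leq_size; first exact: fset_uniq.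
(* [fset_set] of an infinite set is empty. *)
move=> v; have [fin|inf] := pselect (finite_set (@complex_places R k)); last first.
  by rewrite /fset_set; case: pselect => // ?; rewrite in_fset0.
rewrite in_fset_set // inE => -[_ [tau [[x imx] defv]]].
have [i taui] := sigma_surj tau.
have ci : c i != i.
  by apply: contraNneq imx => ci; rewrite taui conj_fixed_Im.
have vi : v = fun x => normc (sigma i x).
  by apply/funext => y; rewrite defv taui.
case up : (upper i).
  by rewrite vi; apply/mapP; exists i; rewrite ?mem_enum.
apply/mapP; exists (c i); first by rewrite mem_enum -[_ \in _]/(upper (c i)) upper_conj // up.
by rewrite vi; apply/funext => y; rewrite normc_conj.
Qed.

Lemma prod_upper (u : R) :
  \prod_i (if c i == i then 1 else if upper i then u else 1) = u ^+ #|upper|.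
Proof.
rewrite -prodr_const [RHS]big_mkcond; apply: eq_bigr => i _; rewrite -[i \in upper]/(upper i).
by case: eqP => // /upper_real/negbTE->.
Qed.

(** A conjugate pair contributes its real part at the [upper] index and its imaginary part at the
    other, so the two squared coordinates add up to the squared modulus, as in the body of
    Minkowski's theorem. *)
Definition real_mx (b : 'I_n -> k) : 'M[R]_n := \matrix_(i, j)
  if (c i == i) || upper i then complex.Re (sigma i (b j))
  else complex.Im (sigma i (b j)).

Lemma real_mx_mul b (z : 'cV[int]_n) i :
  let x := \sum_j b j *~ z j ord0 in
  (real_mx b *m map_mx intr z) i ord0 =
  if (c i == i) || upper i then complex.Re (sigma i x) else complex.Im (sigma i x).
Proof.
move=> x; rewrite mxE.
have ReM (w : C) m : complex.Re (w *~ m) = complex.Re w * m%:~R.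
  rewrite -mulrzr -[m%:~R](rmorph_int (@real_complex_def R (Phant R) : {rmorphism R -> C})).
  by case: w => a b' /=; rewrite mulr0 subr0.
have ImM (w : C) m : complex.Im (w *~ m) = complex.Im w * m%:~R.
  rewrite -mulrzr -[m%:~R](rmorph_int (@real_complex_def R (Phant R) : {rmorphism R -> C})).
  by case: w => a b' /=; rewrite mulr0 add0r.
rewrite /x rmorph_sum Re_sum Im_sum /real_mx.
by case: ifP => ip; apply: eq_bigr => j _; rewrite !mxE ip rmorphMz.
Qed.

(* Congruence by [real_mx] diagonalises the trace form, with eigenvalue 1 at a
   real embedding and 2, -2 at a pair of conjugate ones. *)
Lemma disc_real_mx b :
  `|ratr (\det (trace_form b))| = 4 ^+ #|upper| * \det (real_mx b) ^+ 2 :> R.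
Proof.
pose w : 'rV[R]_n := \row_i if c i == i then 1 else if upper i then 2 else -2.
have formE : map_mx ratr (trace_form b) = (real_mx b)^T *m diag_mx w *m real_mx b.
  apply/matrixP => j l; rewrite mul_mx_diag !mxE.
  have -> : ratr (field_trace (b j * b l)) = \sum_i complex.Re (sigma i (b j * b l)) :> R.
    by rewrite -Re_sum -(ratr_field_trace sigma_inj) ratr_complex.
  under [RHS]eq_bigr => i _ do rewrite !mxE.
  rewrite -(big_conj conj_invol upper_conj) -[RHS](big_conj conj_invol upper_conj).
  have ReMM i : complex.Re (sigma i (b j * b l)) =
     complex.Re (sigma i (b j)) * complex.Re (sigma i (b l)) -
     complex.Im (sigma i (b j)) * complex.Im (sigma i (b l)).
    by rewrite rmorphM; case: (sigma i (b j)) => ? ?; case: (sigma i (b l)).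
  apply: eq_bigr => i _; rewrite Re_conj ReMM.
  have [ci|ci] := eqVneq (c i) i.
    by rewrite !(conj_fixed_Im _ ci) /= mulr1 mulr0 subr0.
  case up : (upper i) => //.
  rewrite conj_invol upper_conj // up eq_sym (negbTE ci) /= !Im_conj.
  by ring.
have := congr1 (fun M => `|\det M|) formE.
rewrite det_map_mx !det_mulmx det_tr det_diag !normrM => ->.
rewrite mulrAC -normrM -expr2 ger0_norm ?sqr_ge0 // mulrC; congr (_ * _).
have -> : 4 ^+ #|upper| = \prod_i `|w ord0 i|.
  rewrite -prod_upper -[RHS](big_conj conj_invol upper_conj).
  apply: eq_bigr => i _; rewrite !mxE; case: eqP => [_|/eqP ci]; first by rewrite normr1.
  case up : (upper i) => //.
  rewrite conj_invol upper_conj // up eq_sym (negbTE ci) /= normrN normr_nat.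
  by ring.
by rewrite normr_prod.
Qed.

Lemma prod_volume :
  \prod_i (if c i == i then 2 else if upper i then pi else 1) =
  2 ^+ n * (pi / 4) ^+ #|upper| :> R.
Proof.
have -> : 2 ^+ n = \prod_(i < n) 2 :> R by rewrite prodr_const card_ord.
rewrite -[\prod_(i < n) 2](big_conj conj_invol upper_conj) -prod_upper -big_split /=.
apply: eq_bigr => i _; case: ifP => _; first by rewrite mulr1.
by case: ifP => _; [field | rewrite mulr1].
Qed.

Lemma small_integer (b : 'I_n -> k) i0 :
  c i0 = i0 -> integral_basis b ->
  exists alpha, [/\ alg_integer alpha, alpha != 0,
    normc (sigma i0 alpha) <=
      (2 / pi) ^+ #|upper| * Num.sqrt `|ratr (\det (trace_form b))|
  & forall i, i != i0 -> normc (sigma i alpha) < 1].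
Proof.
move=> ci0 intb; set D : R := ratr _.
have nzb := integral_basis_det sigma_inj intb; have [intbi _] := intb.
have nzA : \det (real_mx b) != 0.
  have nzD : D != 0.
    rewrite fmorph_eq0 -(fmorph_eq0 (ratr : {rmorphism rat -> C})) /=.
    by rewrite (ratr_disc sigma_inj) expf_neq0.
  apply: contraNneq nzD => A0; rewrite -normr_eq0 disc_real_mx A0.
  by rewrite expr0n mulr0.
have pi0 := pi_gt0 R.
pose T : R := (2 / pi) ^+ #|upper| * Num.sqrt `|D|; rewrite -/T.
have sqrtD : Num.sqrt `|D| = 2 ^+ #|upper| * `|\det (real_mx b)|.
  have -> : `|D| = (2 ^+ #|upper| * \det (real_mx b)) ^+ 2.
    rewrite disc_real_mx exprMn exprAC; congr (_ ^+ _ * _); ring.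
  by rewrite sqrtr_sqr normrM ger0_norm ?exprn_ge0.
(* The bound [T] is chosen to give equality in the volume condition: the discriminant contributes
   [2^#|upper|], the discs [(pi / 4)^#|upper|]. *)
have TE : T * (2 ^+ n * (pi / 4) ^+ #|upper|) = 2 ^+ n * `|\det (real_mx b)|.
  have e : (2 / pi) ^+ #|upper| * 2 ^+ #|upper| * (pi / 4) ^+ #|upper| = 1 :> R.
    have nzpi : pi != 0 :> R by rewrite gt_eqF.
    rewrite -!exprMn (_ : 2 / pi * 2 * (pi / 4) = 1 :> R) ?expr1n //.
    by move: (pi : R) nzpi => q nzq; field.
  by rewrite /T sqrtD mulrCA; congr (_ * _); rewrite mulrA mulrAC e mul1r.
have T0 : 0 < T.
  apply: mulr_gt0; first by rewrite exprn_gt0 // divr_gt0.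
  by rewrite sqrtD mulr_gt0 ?exprn_gt0 ?normr_gt0.
have [|z [nzz le0 ltr ltu]] := minkowski_body_closed conj_invol upper_real upper_conj ci0 nzA T0.
  by rewrite prod_volume TE.
pose alpha := \sum_j b j *~ z j ord0.
have normc_real i : c i = i -> normc (sigma i alpha) = `|(real_mx b *m map_mx intr z) i ord0|.
  move=> ci; rewrite real_mx_mul ci eqxx /= -/alpha.
  case: (sigma i alpha) (conj_fixed_Im alpha ci) => x y /= ->.
  by rewrite expr0n addr0 sqrtr_sqr.
have normc_upper i : upper i -> normc (sigma i alpha) < 1.
  move=> up; have ci : c i != i by apply: contraTneq up => /upper_real.
  have := ltu i up; rewrite !real_mx_mul up orbT conj_invol upper_conj // up orbF.
  rewrite eq_sym (negbTE ci) -/alpha Im_conj sqrrN.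
  case: (sigma i alpha) => x y /= h; rewrite -sqrtr1 ltr_sqrt //.
exists alpha; split.
- apply: (big_ind (@alg_integer k)) => [|u v|j _].
  + exact: mxpoly.integral0.
  + exact: integral_add.
  + rewrite -mulrzl; apply: integral_mul; [exact: integral_id | exact: intbi].
- apply: contraNneq nzz => a0; apply/eqP/matrixP => j o; rewrite (ord1 o) mxE.
  have sum0 : \sum_l ((z l ord0)%:~R : rat) *: b l = 0.
    by rewrite -[RHS]a0; apply: eq_bigr => l _; rewrite scaler_int.
  by have /eqP := independent_basis nzb sum0 j; rewrite intr_eq0 => /eqP.
- by rewrite normc_real.
- move=> i nei; have [ci|ci] := eqVneq (c i) i; first by rewrite normc_real // ltr.
  case up : (upper i); first exact: normc_upper.
  by rewrite -normc_conj normc_upper // upper_conj // up.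
Qed.

End Signature.

(** * Bounding the height of the small integer *)

Theorem theorem1p1 (R : realType) (k : fieldExtType rat) (d s : nat)
    (hd : \dim {:k} = d)
    (hreal : inhabited {rmorphism k -> R})
    (hs : #|` fset_set (@complex_places R k)| = s) :
  exists alpha : k,
    <<1%VS; alpha>>%VS = fullv /\
    weil_height R alpha <=
      (2 / pi) `^ (s%:R / d%:R) *
      `|ratr (field_disc k)| `^ (1 / (2 * d)%:R).
Proof.
have [tau] := hreal; have [theta theta_gen] := exists_primitive k.
have [sigma [sigma_inj sigma_surj]] := exists_embeddings R theta_gen.
have [c conjE] := exists_conj sigma_surj.
have [i0 tauE] := sigma_surj (real_complex R \o tau).
have real0 x : complex.Im (sigma i0 x) = 0 by rewrite -tauE.
have ci0 : c i0 = i0 by apply: (Im_theta_conj_fixed sigma_inj conjE); exact: real0.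
(* The basis [b] is one whose determinant [xget] returns, so the bound for [b] is a bound in terms
   of [field_disc]. *)
have [b [intb defD]] : exists b : 'I_(\dim {:k}) -> k, integral_basis b /\
    field_disc k = \det (trace_form b).
  have [b intb] := exists_integral_basis sigma_inj.
  have := @xgetPex _ 0 [set D : rat | exists2 b', integral_basis b' &
     D = \det (\matrix_(i, j) field_trace (b' i * b' j) : 'M[rat]_(\dim {:k}))].
  case; first by exists (\det (trace_form b)), b.
  by move=> b' intb' eqD; exists b'.
have [alpha [inta nza le0 lt1]] := small_integer sigma_inj conjE ci0 intb.
set a := normc (sigma i0 alpha) in le0.
(* The norm is at least 1 and all other conjugates are below 1. *)
have a_ge1 : 1 <= a.
  apply: le_trans (norm_ge1 sigma_inj intb inta nza) _.
  rewrite (bigD1 i0) //= -[leRHS]mulr1 ler_wpM2l ?normc_ge0 //.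
  by apply: prodr_ile1 => i nei; rewrite normc_ge0 ltW ?lt1.
exists alpha; split.
  apply: (generates_of_conj_neq theta_gen sigma_surj (i0 := i0)) => i nei.
  by apply: contraTneq (lt1 i nei) => ->; rewrite -leNgt.
have d_gt0 : (0 < d)%N by rewrite -hd adim_gt0.
have d0 : 0 < d%:R :> R by rewrite ltr0n.
pose v0 x := normc (sigma i0 x).
pose F (v : k -> R) := Num.max 1 (v alpha) `^ ((local_degree v)%:R / (\dim {:k})%:R).
have F1 v : places v -> v != v0 -> F v = 1.
  move=> [absv ext] /eqP nev; suff le_v : v alpha <= 1.
    by rewrite /F max_l // powR1.
  case: ext => [va|[p pr_p vp]]; last exact (padic_place_le1 intb absv pr_p vp inta).
  rewrite leNgt; apply/negP => gt1; apply: nev.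
  apply: (archimedean_place_eq sigma_inj intb real0 _ a_ge1 absv va gt1) => i nei.
  by rewrite ltW ?lt1.
have height_le : weil_height R alpha <= a `^ (d%:R^-1).
  have a_pow : 1 <= a `^ (d%:R^-1).
    by rewrite -[leLHS](powRr0 a) ler_powR // invr_ge0 ltW.
  have Fv0 : F v0 <= a `^ (d%:R^-1).
    rewrite /F max_r // ler_powR // hd ler_pdivrMr // mulVf ?gt_eqF // lern1.
    by apply: (@local_degree_real _ _ _ tau) => x;
       rewrite /v0 -tauE /= expr0n addr0 sqrtr_sqr.
  rewrite /weil_height -/(F _).
  (* An infinite support would give the empty product 1. Otherwise the duplicate-free support
     contains at most [v0], leaving at most one factor. *)
  case: finite_supportP => [_|X _ _ eqX]; first by rewrite big_nil.
  have X_v0 v : v \in enum_fset X -> v = v0.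
    move=> vX; have : [set` X] v by [].
    by rewrite eqX => -[pv Fv]; apply/eqP; apply: contra_notT Fv => /(F1 _ pv).
  have := fset_uniq X; move: X_v0.
  case: (enum_fset X) => [|u [|w t]] Xv0; first by rewrite big_nil.
    by rewrite big_seq1 (Xv0 u) ?inE //; exact: Fv0.
  rewrite (Xv0 u) ?inE ?eqxx // (Xv0 w) ?inE ?eqxx ?orbT //.
  by rewrite /= inE eqxx.
apply: (le_trans height_le).
have pi2 : 0 <= 2 / pi :> R by rewrite divr_ge0 // pi_ge0.
have pi2_le1 : 2 / pi <= 1 :> R by rewrite ler_pdivrMr ?pi_gt0 // mul1r pi_ge2.
set D : R := ratr _.
(* Replacing [#|upper|] by the possibly smaller exponent [s] can only increase the power of
   [2 / pi <= 1]. *)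
have le_a : a <= (2 / pi) ^+ s * Num.sqrt `|D|.
  apply: (le_trans le0); rewrite -defD ler_wpM2r ?sqrtr_ge0 //.
  by rewrite ler_wiXn2l // -hs (card_complex_places sigma_inj sigma_surj conjE).
apply: (@le_trans _ _ (((2 / pi) ^+ s * Num.sqrt `|D|) `^ (d%:R^-1))).
  by rewrite ge0_ler_powR ?nnegrE ?invr_ge0 ?(ltW d0) ?mulr_ge0 ?exprn_ge0 ?sqrtr_ge0 ?normc_ge0.
rewrite powRM ?exprn_ge0 ?sqrtr_ge0 // -powR_mulrn // -powRrM.
by rewrite -powR12_sqrt // -powRrM natrM invfM mul1r.
Qed.
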